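(* Let $a>0$ and put $$\mathcal{P}_a=\left\{(b,c):\ b>a,\ c\ge\max\left[3a+\tfrac12-b,\ a+\tfrac{a}{2(b-a)}\right]\right\},\qquad \mathcal{S}_a=\left\{(a+\tfrac12,\,2a),\ (2a,\,a+\tfrac12)\right\}.$$ If $(b,c)\in\mathcal{P}_a\setminus\mathcal{S}_a$, then the function $$\Phi(z)={}_1F_2\left[\begin{array}{c}a\\ b,\,c\end{array}\Big|-\frac{z^2}{4}\right]\qquad(z\in\mathbb{C})$$ does not belong to $\mathcal{LP}$, and $\Phi(z)$ has infinitely many complex (non-real) zeros, none of which is purely imaginary.
   Context: ${}_1F_2\left[\begin{array}{c}a\\ b,\,c\end{array}\Big|\,w\right]=\sum_{k=0}^\infty\frac{(a)_k}{k!\,(b)_k(c)_k}w^k$, where $(x)_k$ is the Pochhammer symbol (rising factorial). The Laguerre–Pólya class $\mathcal{LP}$ is the class of all real entire functions $g$ having only real zeros, if any, which are representable in the form $g(z)=Az^\ell e^{-\alpha z^2+\beta z}\prod_{m=1}^\omega\left(1-\frac{z}{\sigma_m}\right)e^{z/\sigma_m}$, $0\le\omega\le\infty$, where $A,\alpha,\beta$ are real with $\alpha\ge0$, $\ell$ is a nonnegative integer and $(\sigma_m)$ is a sequence of non-zero reals with $\sum_{m=1}^\omega 1/\sigma_m^2<\infty$. *)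

(* Defs.v *)
From Stdlib Require Export Arith Reals Finite_sets.
From Coquelicot Require Export Coquelicot.
From Stdlib Require Import Lra Lia.

Open Scope R_scope.

(* Coquelicot's [Series] is real-valued only.  Like it, [CSeries u] is a junk
   value when the series diverges. *)
Definition CSeries (u : nat -> C) : C :=
  (Series (fun k => Re (u k)), Series (fun k => Im (u k))).

Definition Cexp (z : C) : C :=
  (exp (Re z) * cos (Im z), exp (Re z) * sin (Im z)).

Fixpoint Cprod_n (u : nat -> C) (n : nat) : C :=
  match n with
  | O => 1
  | S n' => Cprod_n u n' * u n'
  end%C.

(* A plain limit of partial products: the value may be zero, as it must be at
   a zero of one of the factors. *)
Definition is_Cprod (u : nat -> C) (p : C) : Prop :=
  filterlim (Cprod_n u) eventually (locally p).

Fixpoint pochhammer (x : R) (k : nat) : R :=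
  match k with
  | O => 1
  | S k' => pochhammer x k' * (x + INR k')
  end.

Definition hyp1F2_coeff (a b c : R) (k : nat) : R :=
  pochhammer a k / (INR (fact k) * pochhammer b k * pochhammer c k).

Definition hyp1F2 (a b c : R) (w : C) : C :=
  CSeries (fun k => (RtoC (hyp1F2_coeff a b c k) * w ^ k)%C).

(* [ex_derive] is taken over the field [C] (complex differentiability), not
   over [R]. *)
Definition entire (g : C -> C) : Prop :=
  forall z : C, @ex_derive C_AbsRing C_NormedModule g z.

Definition real_entire (g : C -> C) : Prop :=
  entire g /\ forall x : R, Im (g (RtoC x)) = 0.

(* The number [omega] of factors is [Some n] for a finite product and [None]
   for an infinite one; the indices [m] start at 0 instead of 1. *)
Definition index_lt (m : nat) (omega : option nat) : bool :=
  match omega with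
  | Some n => Nat.ltb m n
  | None => true
  end.

Definition LP_factor (omega : option nat) (sigma : nat -> R) (z : C)
    (m : nat) : C :=
  if index_lt m omega
  then ((1 - z / RtoC (sigma m)) * Cexp (z / RtoC (sigma m)))%C
  else RtoC 1.

Definition LP_representable (g : C -> C) : Prop :=
  exists (A alpha beta : R) (l : nat) (omega : option nat) (sigma : nat -> R),
    0 <= alpha /\
    (forall m : nat, index_lt m omega = true -> sigma m <> 0) /\
    ex_series (fun m => if index_lt m omega then / (sigma m) ^ 2 else 0) /\
    forall z : C, exists p : C,
      is_Cprod (LP_factor omega sigma z) p /\
      g z = (RtoC A * z ^ l
             * Cexp (- RtoC alpha * z ^ 2 + RtoC beta * z) * p)%C.

Definition laguerre_polya (g : C -> C) : Prop :=
  real_entire g /\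
  (forall z : C, g z = RtoC 0 -> Im z = 0) /\
  LP_representable g.

Definition region_P (a : R) (bc : R * R) : Prop :=
  let (b, c) := bc in
  b > a /\ c >= Rmax (3 * a + 1 / 2 - b) (a + a / (2 * (b - a))).

Definition set_S (a : R) (bc : R * R) : Prop :=
  bc = (a + 1 / 2, 2 * a) \/ bc = (2 * a, a + 1 / 2).

Lemma CSeries_unique (u : nat -> C) (s : C) :
  @is_series C_AbsRing C_NormedModule u s -> CSeries u = s.
Proof.
intros H.
assert (Hn : forall n, sum_n u n
   = (sum_n (fun k => Re (u k)) n, sum_n (fun k => Im (u k)) n) :> C).
{ induction n as [|n IH].
  - rewrite !sum_O. now destruct (u O).
  - rewrite !sum_Sn, IH. reflexivity. }
assert (Hb : forall eps : posreal, eventually (fun n =>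
   Rabs (sum_n (fun k => Re (u k)) n - Re s) < eps /\
   Rabs (sum_n (fun k => Im (u k)) n - Im s) < eps)).
{ intros eps.
  destruct (H (ball s eps) (locally_ball s eps)) as [N HN].
  exists N; intros n Hle. specialize (HN n Hle).
  rewrite Hn in HN. destruct HN as [H1 H2]. split; [exact H1 | exact H2]. }
unfold CSeries. rewrite (surjective_pairing s).
apply f_equal2; apply is_series_unique; apply filterlim_locally; intros eps;
  destruct (Hb eps) as [N HN]; exists N; intros n Hle;
  destruct (HN n Hle) as [H1 H2]; assumption.
Qed.

Lemma pochhammer_pos (x : R) (k : nat) : 0 < x -> 0 < pochhammer x k.
Proof.
intros Hx. induction k as [|k IH]; simpl; [lra|].
apply Rmult_lt_0_compat; [exact IH|]. pose proof (pos_INR k). lra.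
Qed.

Lemma CSeries_correct (u : nat -> C) (v : nat -> R) :
  (forall k, Cmod (u k) <= v k) -> ex_series v ->
  @is_series C_AbsRing C_NormedModule u (CSeries u).
Proof.
intros Hle Hv.
assert (HR : ex_series (fun k => Re (u k))).
{ apply (@ex_series_le R_AbsRing R_CompleteNormedModule _ v); [|exact Hv].
  intros k. eapply Rle_trans; [apply re_le_Cmod | apply Hle]. }
assert (HI : ex_series (fun k => Im (u k))).
{ apply (@ex_series_le R_AbsRing R_CompleteNormedModule _ v); [|exact Hv].
  intros k. eapply Rle_trans; [|apply Hle].
  eapply Rle_trans; [apply Rmax_r | apply Rmax_Cmod]. }
apply Series_correct in HR. apply Series_correct in HI.
assert (Hn : forall n, sum_n u n
   = (sum_n (fun k => Re (u k)) n, sum_n (fun k => Im (u k)) n) :> C).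
{ induction n as [|n IH].
  - rewrite !sum_O. now destruct (u O).
  - rewrite !sum_Sn, IH. reflexivity. }
intros P [eps HP].
assert (Hs : 0 < eps / 2) by (destruct eps; simpl; lra).
destruct (HR (ball (Series (fun k => Re (u k))) (mkposreal _ Hs))
            (locally_ball _ _)) as [N1 H1].
destruct (HI (ball (Series (fun k => Im (u k))) (mkposreal _ Hs))
            (locally_ball _ _)) as [N2 H2].
exists (max N1 N2). intros n Hmax. apply HP.
assert (E1 := H1 n ltac:(lia)). assert (E2 := H2 n ltac:(lia)).
rewrite Hn.
split; simpl; (apply ball_le with (eps / 2); [lra | assumption]).
Qed.

Lemma hyp1F2_correct (a b c : R) (w : C) : 0 < a -> 0 < b -> 0 < c ->
  @is_series C_AbsRing C_NormedModule
    (fun k => (RtoC (hyp1F2_coeff a b c k) * w ^ k)%C) (hyp1F2 a b c w).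
Proof.
intros Ha Hb Hc.
set (K := 1 + a / b).
assert (HK : forall k, a + INR k <= K * (b + INR k)).
{ intros k. unfold K. pose proof (pos_INR k) as Hk.
  assert (0 <= a / b) by (apply Rlt_le, Rdiv_lt_0_compat; lra).
  replace ((1 + a / b) * (b + INR k)) with (a + INR k + b + a / b * INR k)
    by (field; lra).
  pose proof (Rmult_le_pos _ _ H Hk). lra. }
assert (HK0 : 0 < K).
{ unfold K. assert (0 < a / b) by (apply Rdiv_lt_0_compat; lra). lra. }
assert (Hden : forall k, 0 < INR (fact k) * pochhammer b k * pochhammer c k).
{ intros k. pose proof (pochhammer_pos b k Hb).
  pose proof (pochhammer_pos c k Hc). pose proof (INR_fact_lt_0 k).
  repeat apply Rmult_lt_0_compat; assumption. }
assert (Hco : forall k, 0 < hyp1F2_coeff a b c k).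
{ intros k. apply Rdiv_lt_0_compat; [now apply pochhammer_pos | apply Hden]. }
assert (Hbd : forall k, hyp1F2_coeff a b c k <= (K / c) ^ k / INR (fact k)).
{ induction k as [|k IH].
  - unfold hyp1F2_coeff; simpl. lra.
  - pose proof (pochhammer_pos b k Hb) as Pb.
    pose proof (pochhammer_pos c k Hc) as Pc.
    pose proof (INR_fact_lt_0 k) as Pf.
    pose proof (pos_INR k) as Pk.
    assert (Hstep : hyp1F2_coeff a b c (S k) = hyp1F2_coeff a b c k
       * ((a + INR k) / (b + INR k) * / (c + INR k) * / INR (S k))).
    { unfold hyp1F2_coeff. rewrite fact_simpl, mult_INR, S_INR.
      simpl pochhammer. field. repeat split; lra. }
    rewrite Hstep.
    replace ((K / c) ^ S k / INR (fact (S k)))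
      with ((K / c) ^ k / INR (fact k) * (K * / c * / INR (S k))).
    2: { rewrite fact_simpl, mult_INR, S_INR. simpl pow. field.
         repeat split; lra. }
    assert (P1 : 0 <= (a + INR k) / (b + INR k))
      by (apply Rlt_le, Rdiv_lt_0_compat; lra).
    assert (P2 : 0 < / (c + INR k)) by (apply Rinv_0_lt_compat; lra).
    assert (P3 : 0 < / INR (S k))
      by (apply Rinv_0_lt_compat; rewrite S_INR; lra).
    apply Rmult_le_compat; [apply Rlt_le, Hco | | exact IH |].
    { apply Rmult_le_pos; [apply Rmult_le_pos|]; lra. }
    apply Rmult_le_compat_r; [lra|].
    apply Rmult_le_compat; [lra | lra | |].
    + apply Rle_div_l; [lra | apply HK].
    + apply Rinv_le_contravar; lra. }
apply CSeries_correct
  with (fun k => / INR (fact k) * (K / c * Cmod w) ^ k).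
- intros k. rewrite Cmod_mult, Cmod_R, Cmod_pow.
  rewrite (Rabs_pos_eq _ (Rlt_le _ _ (Hco k))), Rpow_mult_distr.
  rewrite <- Rmult_assoc. apply Rmult_le_compat_r.
  + apply pow_le, Cmod_ge_0.
  + rewrite Rmult_comm. apply Hbd.
- exists (exp (K / c * Cmod w)).
  apply is_pseries_R, is_exp_Reals.
Qed.

(* Main.v *)
Require Import Defs.
From Stdlib Require Import Lra Lia List ClassicalEpsilon.
From mathcomp Require all_boot all_algebra complex Rstruct.

Open Scope R_scope.

(** On the real line the function is a sum of squares of Bessel functions
    (Gasper).  With [2 s = b + c - a - 1/2] and [W = x^2 / 4],
    [1F2 (a; b, c; - W) = sum_n D_n W^n (0F1 (; s + n + 1/2; - W / 4))^2],
    where [D_n] is a positive multiple of a terminating balanced 4F3.  Whipple's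
    transformation turns this 4F3 into a positive multiple of the coefficient
    of [t^n] in [2F1 (-1/2, a; s; t) * 2F1 (b - a, c - a; s; t)].  In this
    coefficient only the first summand is positive, and relative to it the
    others are largest in absolute value at the two points of [S_a], where the
    product is [1].  So [D_n >= 0] on [P_a], strictly off [S_a] for [n >= 2],
    and there are no real zeros.

    As a function of [w = z^2] the series has order at most 1/2.  If it had
    finitely many zeros, dividing them out would leave a zero-free function of
    the same growth.  The zeros of the Taylor polynomials of the latter tend to
    infinity, and by the growth bound the sums of their reciprocals tend to 0,
    so it is constant: the original function would be a polynomial.  It is
    not, so there are infinitely many zeros, all non-real. *)

(** With [p = b - a] and [q = c - a], where b > a, the region P_a reads p + q >= a + 1/2, which is
    the same as s >= a, and p q >= a/2. Equality in both means {p, q} = {a, 1/2}, which is S_a;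
    there s = a and the two 2F1 factors are (1 - t)^(1/2) and (1 - t)^(-1/2). The comparison of
    summands therefore has to use p and q only through their sum and product. Nonnegative
    coefficients alone do not exclude a real zero: at each point some square with positive
    coefficient must be non-zero. It is found at an index n that is large against W, where the
    Bessel series stays close to its first term 1. On the complex side, no contour integrals are
    used. The maximum principle at the origin comes from averaging over roots of unity, and zeros
    are counted for finite products, with bounds that do not depend on the degree. A finite set of
    zeros does not bound multiplicities, so it also has to be shown that dividing zeros out comes to
    an end. *)

(** The list holds the reciprocals of the zeros: the value at 0 is then 1, and the sum of the moduli
    of the entries controls the distance from 1. *)
Definition lin_prod (l : list C) (w : C) : C :=
  fold_right (fun u acc => ((1 - w * u) * acc)%C) (RtoC 1) l.

(** * Factorization of complex polynomials *)

Module FTA.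
Import mathcomp.boot.all_boot mathcomp.algebra.all_algebra mathcomp.real_closed.complex Rstruct.
Import GRing.Theory.
Local Open Scope ring_scope.

Definition ofC (z : C) : R[i] := Complex (fst z) (snd z).
Definition toC (z : R[i]) : C := let: Complex x y := z in (x, y).

Lemma ofCK z : toC (ofC z) = z. Proof. by case: z. Qed.
Lemma toC1 : toC 1 = RtoC 1%R. Proof. by []. Qed.
Lemma toCD x y : toC (x + y) = Cplus (toC x) (toC y).
Proof. by case: x y => [a b] [c d]. Qed.
Lemma toCM x y : toC (x * y) = Cmult (toC x) (toC y).
Proof. by case: x y => [a b] [c d]. Qed.
Lemma toCB x y : toC (x - y) = Cminus (toC x) (toC y).
Proof. by case: x y => [a b] [c d]. Qed.
Lemma toCX x n : toC (x ^+ n) = Cpow (toC x) n.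
Proof. by elim: n => [|n IH] //; rewrite exprS toCM IH. Qed.

(** The polynomial splits over the algebraically closed field [R[i]]. Its value 1 at the origin
    shows that no root is 0 and that the leading coefficient is the inverse of the product of the
    negated roots, so every factor can be normalized to 1 at the origin. *)
Lemma poly_factor (h : nat -> C) (n : nat) : h O = RtoC 1%R ->
  exists l : list C, forall w : C,
    sum_n (fun k => Cmult (h k) (Cpow w k)) n = lin_prod l w.
Proof.
move=> h0; pose P : {poly R[i]} := \poly_(i < n.+1) ofC (h i).
have evP w : toC P.[ofC w] = sum_n (fun k => Cmult (h k) (Cpow w k)) n.
  rewrite /P horner_poly; elim: n {P} => [|n IH].
    by rewrite big_ord_recl big_ord0 addr0 sum_O toCM toCX !ofCK.
  by rewrite big_ord_recr toCD IH sum_Sn /= toCM toCX !ofCK.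
have [r defP] := closed_field_poly_normal P.
have P0 : P.[0] = 1.
  rewrite /P horner_poly big_ord_recl big1 => [|i _]; last by rewrite expr0n mulr0.
  by rewrite /= expr0 mulr1 addr0 h0.
exists [seq toC z^-1 | z <- r] => w; rewrite -evP.
have prodE (x : R[i]) : P.[x] = lead_coef P * \prod_(z <- r) (x - z).
  rewrite {1}defP hornerZ horner_prod; congr (_ * _).
  by apply: eq_bigr => z _; rewrite !hornerE.
have nz : \prod_(z <- r) (0 - z) != 0.
  by apply/eqP => e; move: P0; rewrite prodE e mulr0 => /esym /eqP; rewrite oner_eq0.
have lcE : lead_coef P = (\prod_(z <- r) (0 - z))^-1.
  by apply: (mulIf nz); rewrite -prodE P0 mulVf.
rewrite prodE lcE {P evP defP P0 prodE lcE}.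
elim: r nz => [|z r IH]; first by rewrite !big_nil invr1 mulr1.
rewrite !big_cons mulf_eq0 negb_or sub0r oppr_eq0 => /andP[z0 /IH {}IH].
rewrite invfM mulrACA toCM IH /=; congr Cmult.
rewrite -toC1 -[in RHS](ofCK w) -toCM -toCB; congr toC.
by rewrite invrN mulNr mulrBr mulVf // opprB mulrC.
Qed.
End FTA.

(** * Terminating hypergeometric sums *)

Notation poch := pochhammer.
Notation sum := sum_f_R0.

Lemma poch_S_l (x : R) (k : nat) : poch x (S k) = x * poch (x + 1) k.
Proof.
induction k as [|k IH]; [simpl; ring|].
change (poch x (S (S k))) with (poch x (S k) * (x + INR (S k))).
rewrite IH, S_INR. simpl. ring.
Qed.

Lemma poch_plus (x : R) (m n : nat) :
  poch x (m + n) = poch x m * poch (x + INR m) n.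
Proof.
induction n as [|n IH]; [rewrite Nat.add_0_r; simpl; ring|].
rewrite Nat.add_succ_r. simpl. rewrite IH, plus_INR. ring.
Qed.

Lemma poch_neq0 (x : R) (k : nat) : 0 < x -> poch x k <> 0.
Proof. intros H. apply Rgt_not_eq, pochhammer_pos, H. Qed.

Lemma poch_le (x y : R) (k : nat) : 0 < x <= y -> poch x k <= poch y k.
Proof.
intros H. induction k as [|k IH]; simpl; [lra|].
pose proof (pos_INR k). pose proof (pochhammer_pos x k (proj1 H)).
apply Rmult_le_compat; lra.
Qed.

Lemma fact_S_INR (n : nat) : INR (fact (S n)) = (INR n + 1) * INR (fact n).
Proof. rewrite fact_simpl, mult_INR, S_INR. ring. Qed.

Lemma sign_sqr (n : nat) : (-1) ^ n * (-1) ^ n = 1.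
Proof. rewrite <- Rpow_mult_distr. replace (-1 * -1) with 1 by ring. apply pow1. Qed.

(** Reversal of the order of the factors, kept free of division because [poch x (n - i)] may
    vanish. *)
Lemma poch_reflect (x : R) (n i : nat) : (i <= n)%nat ->
  poch (1 - x - INR n) i * poch x (n - i) = (-1) ^ i * poch x n.
Proof.
induction i as [|i IH]; intros Hi; [rewrite Nat.sub_0_r; simpl; ring|].
replace (n - i)%nat with (S (n - S i)) in IH by lia.
specialize (IH ltac:(lia)).
change (poch (1 - x - INR n) (S i)) with (poch (1 - x - INR n) i * (1 - x - INR n + INR i)).
replace ((-1) ^ S i * poch x n) with (- ((-1) ^ i * poch x n)) by (simpl; ring).
rewrite <- IH. simpl. rewrite minus_INR, S_INR by lia. ring.
Qed.

Lemma poch_opp (n i : nat) : (i <= n)%nat ->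
  poch (- INR n) i * INR (fact (n - i)) = (-1) ^ i * INR (fact n).
Proof.
induction i as [|i IH]; intros Hi; [rewrite Nat.sub_0_r; simpl; ring|].
replace (n - i)%nat with (S (n - S i)) in IH by lia.
specialize (IH ltac:(lia)). rewrite fact_S_INR, minus_INR, S_INR in IH by lia.
replace ((-1) ^ S i * INR (fact n)) with (- ((-1) ^ i * INR (fact n)))
  by (simpl; ring).
rewrite <- IH. simpl. ring.
Qed.

Lemma sum_exchange (f : nat -> nat -> R) (K : nat) :
  sum (fun k => sum (fun n => f n (k - n)%nat) k) K
  = sum (fun n => sum (fun m => f n m) (K - n)) K.
Proof.
induction K as [|K IH]; [reflexivity|].
rewrite tech5, IH.
rewrite !(tech5 _ K), Nat.sub_diag. simpl (sum _ 0).
rewrite <- Rplus_assoc. f_equal. rewrite <- sum_plus. apply sum_eq.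
intros i Hi. rewrite Nat.sub_succ_l by lia. now rewrite tech5.
Qed.

(** The coefficient of t^k in (1 - t)^(-x). *)
Definition rp (x : R) (k : nat) : R := poch x k / INR (fact k).

Lemma rp_S (x : R) (k : nat) : (INR k + 1) * rp x (S k) = (x + INR k) * rp x k.
Proof.
unfold rp. rewrite fact_S_INR. simpl. pose proof (INR_fact_lt_0 k). pose proof (pos_INR k).
field. lra.
Qed.

(** Chu-Vandermonde. In the induction the factor n + 1 is split as i + (n + 1 - i), and the
    recurrence [rp_S] absorbs each part into one of the two factors. *)
Lemma vandermonde (x y : R) (n : nat) :
  sum (fun i => rp x i * rp y (n - i)) n = rp (x + y) n.
Proof.
induction n as [|n IH]; [unfold rp; simpl; field|].
apply Rmult_eq_reg_l with (INR n + 1); [|pose proof (pos_INR n); lra].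
rewrite rp_S, <- IH, !scal_sum.
rewrite (sum_eq _ (fun i => INR i * rp x i * rp y (S n - i)
   + rp x i * (INR (S n - i) * rp y (S n - i)))) by
 (intros i Hi; rewrite minus_INR, S_INR by lia; ring).
rewrite sum_plus, (decomp_sum (fun i => INR i * _ * _)) by lia.
rewrite (tech5 (fun i => rp x i * _)), Nat.sub_diag. simpl pred. simpl (INR 0).
rewrite !Rmult_0_l, Rplus_0_l, Rmult_0_r, Rplus_0_r, <- sum_plus.
apply sum_eq. intros i Hi.
rewrite (Nat.sub_succ_l i n) by lia. simpl (S n - S i)%nat.
rewrite !S_INR, !rp_S. rewrite minus_INR by lia. ring.
Qed.

(** Term k of the balanced 3F2 (-n, A, B; C0, 1 + A + B - C0 - n; 1), multiplied by (C0)_n (C0 - A -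
    B)_n / n!, which makes it polynomial in the parameters. *)
Definition saal_term (A B C0 : R) (n k : nat) : R :=
  poch A k * poch B k * poch (C0 - A - B) (n - k) * poch (C0 + INR k) (n - k)
  / (INR (fact k) * INR (fact (n - k))).

(* The difference of the two sides of the recurrence in [n] telescopes in [k] (Gosper). *)
Lemma saal_partial (A B C0 : R) (n M : nat) : (M <= n)%nat ->
  sum (fun k => (INR n + 1) * saal_term A B C0 (S n) k
        - (C0 - A + INR n) * (C0 - B + INR n) * saal_term A B C0 n k) M
  = - (A + INR M) * (B + INR M) * saal_term A B C0 n M.
Proof.
induction M as [|M IH]; intros HM.
- unfold saal_term. cbn [sum_f_R0]. simpl (INR 0). rewrite !Nat.sub_0_r.
  cbn [pochhammer]. rewrite fact_S_INR. simpl (INR (fact 0)).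
  rewrite !Rplus_0_r.
  pose proof (INR_fact_lt_0 n). pose proof (pos_INR n). field. lra.
- rewrite tech5, IH by lia.
  destruct (Nat.le_exists_sub _ _ HM) as [m [-> _]].
  unfold saal_term.
  replace (S (m + S M) - S M)%nat with (S m) by lia.
  replace (m + S M - M)%nat with (S m) by lia.
  replace (m + S M - S M)%nat with m by lia.
  rewrite (poch_S_l (C0 + INR M)). rewrite S_INR.
  replace (C0 + (INR M + 1)) with (C0 + INR M + 1) by ring.
  cbn [pochhammer]. rewrite !fact_S_INR, plus_INR, S_INR.
  pose proof (INR_fact_lt_0 m). pose proof (pos_INR m).
  pose proof (INR_fact_lt_0 M). pose proof (pos_INR M). field. lra.
Qed.

Lemma saalschuetz (A B C0 : R) (n : nat) :
  sum (saal_term A B C0 n) n = poch (C0 - A) n * poch (C0 - B) n / INR (fact n).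
Proof.
induction n as [|n IH]; [unfold saal_term; simpl; field|].
pose proof (saal_partial A B C0 n n (Nat.le_refl n)) as H.
rewrite minus_sum in H.
rewrite (sum_eq _ (fun k => saal_term A B C0 (S n) k * (INR n + 1))),
  <- scal_sum, (sum_eq (fun k => _ * saal_term A B C0 n k)
    (fun k => saal_term A B C0 n k * ((C0 - A + INR n) * (C0 - B + INR n)))),
  <- scal_sum, IH in H by (intros; ring).
pose proof (INR_fact_lt_0 n). pose proof (pos_INR n).
apply Rmult_eq_reg_l with (INR n + 1); [|lra].
rewrite tech5, Rmult_plus_distr_l, (Rmult_comm (INR n + 1)).
(* The extra term k = n + 1 of the longer sum cancels the boundary term left by the telescoping. *)
assert (HL : (INR n + 1) * saal_term A B C0 (S n) (S n)
   = (A + INR n) * (B + INR n) * saal_term A B C0 n n).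
{ unfold saal_term. rewrite !Nat.sub_diag, fact_S_INR. cbn [pochhammer].
  simpl (INR (fact 0)). field. lra. }
assert (HR : (INR n + 1) * (poch (C0 - A) (S n) * poch (C0 - B) (S n) / INR (fact (S n)))
   = (C0 - A + INR n) * (C0 - B + INR n)
     * (poch (C0 - A) n * poch (C0 - B) n / INR (fact n))).
{ rewrite fact_S_INR. cbn [pochhammer]. field. lra. }
rewrite HL, HR. lra.
Qed.

(** * Whipple's transformation *)

Definition whipple_lhs (a b c s : R) (n : nat) : R :=
  sum (fun j => poch (- INR n) j * poch (2 * s + INR n - 1) j * poch a j
     * poch (s + 1 / 2) j
     / (INR (fact j) * poch b j * poch c j * poch s j)) n.

(** n! times the coefficient of t^n in 2F1 (-1/2, a; s; t) 2F1 (p, q; s; t). *)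
Definition whipple_rhs (a p q s : R) (n : nat) : R :=
  sum (fun i => INR (fact n) / (INR (fact i) * INR (fact (n - i)))
     * poch (- (1 / 2)) i * (poch a i / poch s i)
     * (poch p (n - i) * poch q (n - i) / poch s (n - i))) n.

(** A Saalschütz sum with A = a + i, B = 2 s + N - 1/2 and C0 = b + i. The relation between s and a,
    b, c turns C0 - B into 1 - (c - a) - (N - i), whose rising factorial of length N - i reverses to
    that of c - a. *)
Lemma whipple_inner (a b c s : R) (N i : nat) :
  0 < b -> 0 < c -> 2 * s = b + c - a - 1 / 2 -> (i <= N)%nat ->
  sum (fun l => poch (a + INR i) l * poch (2 * s + INR N - 1 / 2) l * (-1) ^ l
      / (INR (fact l) * INR (fact (N - i - l)) * poch b (i + l) * poch c (i + l)))
    (N - i)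
  = poch (b - a) (N - i) * poch (c - a) (N - i)
    / (INR (fact (N - i)) * poch b N * poch c N).
Proof.
intros Hb Hc Hs Hi.
set (M := (N - i)%nat).
pose proof (poch_neq0 b N Hb) as Pb. pose proof (poch_neq0 c N Hc) as Pc.
pose proof (INR_fact_neq_0 M) as PM.
pose proof (saalschuetz (a + INR i) (2 * s + INR N - 1 / 2) (b + INR i) M) as H.
replace (b + INR i - (a + INR i)) with (b - a) in H by ring.
replace (b + INR i - (2 * s + INR N - 1 / 2)) with (1 - (c - a) - INR M) in H
  by (unfold M; rewrite minus_INR by lia; lra).
pose proof (poch_reflect (c - a) M M (Nat.le_refl M)) as HM.
rewrite Nat.sub_diag, Rmult_1_r in HM. rewrite HM in H. clear HM.
pose proof (sign_sqr M) as Hs1.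
transitivity (((-1) ^ M / (poch b N * poch c N))
  * (poch (b - a) M * ((-1) ^ M * poch (c - a) M) / INR (fact M))).
2:{ replace (poch (b - a) M * poch (c - a) M)
      with (((-1) ^ M * (-1) ^ M) * (poch (b - a) M * poch (c - a) M))
      by (rewrite Hs1; ring). field. auto. }
rewrite <- H, scal_sum. apply sum_eq. intros l Hl. unfold saal_term.
replace (b + INR i - (a + INR i) - (2 * s + INR N - 1 / 2)) with (1 - c - INR N) by lra.
pose proof (poch_reflect c N (M - l) ltac:(unfold M; lia)) as HD.
replace (N - (M - l))%nat with (i + l)%nat in HD by (unfold M in *; lia).
pose proof (poch_plus b (i + l) (M - l)) as HB.
replace (i + l + (M - l))%nat with N in HB by (unfold M in *; lia).
rewrite plus_INR, <- Rplus_assoc in HB.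
pose proof (poch_neq0 b (i + l) Hb) as Pbl. pose proof (poch_neq0 c (i + l) Hc) as Pcl.
pose proof (INR_fact_neq_0 l). pose proof (INR_fact_neq_0 (M - l)).
apply Rmult_eq_reg_r with (poch c (i + l)); [|auto].
transitivity (poch (a + INR i) l * poch (2 * s + INR N - 1 / 2) l
  * (poch (1 - c - INR N) (M - l) * poch c (i + l)) * poch (b + INR i + INR l) (M - l)
  / (INR (fact l) * INR (fact (M - l))) * ((-1) ^ M / (poch b N * poch c N))).
2: field; auto.
assert (HZ : poch (b + INR i + INR l) (M - l) <> 0)
  by (intros E; rewrite E, Rmult_0_r in HB; auto).
rewrite HD, HB.
assert (Hs2 : (-1) ^ l = (-1) ^ (M - l) * (-1) ^ M).
{ replace M with (M - l + l)%nat at 2 by lia. rewrite pow_add, <- Rmult_assoc.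
  rewrite <- Rpow_mult_distr. replace (-1 * -1) with 1 by ring. rewrite pow1. ring. }
rewrite Hs2. field. repeat split; auto.
Qed.

(** Saalschütz is used twice. The factor (s + 1/2)_j (2 s + n - 1)_j / j! is itself such a sum, with
    A = -1/2, B = 1 - s - n and C0 = s; once it is inserted and the summations are exchanged,
    [whipple_inner] evaluates the other sum. The -1/2 here is the origin of the (-1/2)_i in
    [whipple_rhs]. *)
Lemma whipple (a b c s : R) (n : nat) :
  0 < b -> 0 < c -> 0 < s -> 2 * s = b + c - a - 1 / 2 ->
  whipple_lhs a b c s n
  = poch s n / (poch b n * poch c n) * whipple_rhs a (b - a) (c - a) s n.
Proof.
intros Hb Hc H0s Hs. unfold whipple_lhs, whipple_rhs.
set (phi := fun i l => poch (- INR n) (i + l) * poch a (i + l)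
   / (poch b (i + l) * poch c (i + l))
   * (poch (- (1 / 2)) i * poch (1 - s - INR n) i * poch (2 * s + INR n - 1 / 2) l
   / (poch s i * INR (fact i) * INR (fact l)))).
transitivity (sum (fun j => sum (fun i => phi i (j - i)%nat) j) n).
- apply sum_eq. intros j Hj.
  pose proof (saalschuetz (- (1 / 2)) (1 - s - INR n) s j) as H.
  replace (s - - (1 / 2)) with (s + 1 / 2) in H by lra.
  replace (s - (1 - s - INR n)) with (2 * s + INR n - 1) in H by lra.
  pose proof (poch_neq0 b j Hb) as Pb. pose proof (poch_neq0 c j Hc) as Pc.
  pose proof (poch_neq0 s j H0s) as Ps. pose proof (INR_fact_neq_0 j) as Pj.
  transitivity (poch (- INR n) j * poch a j / (poch b j * poch c j * poch s j)
    * (poch (s + 1 / 2) j * poch (2 * s + INR n - 1) j / INR (fact j))).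
  { field. auto. }
  rewrite <- H, scal_sum. apply sum_eq. intros i Hi. unfold phi, saal_term.
  replace (i + (j - i))%nat with j by lia.
  replace (s + 1 / 2 - (1 - s - INR n)) with (2 * s + INR n - 1 / 2) by lra.
  replace (s - - (1 / 2) - (1 - s - INR n)) with (2 * s + INR n - 1 / 2) by lra.
  pose proof (poch_plus s i (j - i)) as HB. replace (i + (j - i))%nat with j in HB by lia.
  pose proof (poch_neq0 s i H0s). pose proof (INR_fact_neq_0 i).
  pose proof (INR_fact_neq_0 (j - i)).
  assert (HZ : poch (s + INR i) (j - i) <> 0)
    by (intros E; rewrite E, Rmult_0_r in HB; auto).
  rewrite HB. field. repeat split; auto.
- rewrite sum_exchange, scal_sum. apply sum_eq. intros i Hi.
  pose proof (whipple_inner a b c s n i Hb Hc Hs Hi) as H.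
  pose proof (poch_neq0 b n Hb) as Pb. pose proof (poch_neq0 c n Hc) as Pc.
  pose proof (poch_neq0 s i H0s) as Psi. pose proof (poch_neq0 s (n - i) H0s) as Psn.
  pose proof (INR_fact_neq_0 i) as Pi. pose proof (INR_fact_neq_0 (n - i)) as Pni.
  pose proof (poch_reflect s n i Hi) as Hr.
  transitivity ((-1) ^ i * INR (fact n) * poch a i * poch (- (1 / 2)) i
     * poch (1 - s - INR n) i / (poch s i * INR (fact i))
     * (poch (b - a) (n - i) * poch (c - a) (n - i)
    / (INR (fact (n - i)) * poch b n * poch c n))).
  + rewrite <- H, scal_sum. apply sum_eq. intros l Hl. unfold phi.
    pose proof (poch_opp n (i + l) ltac:(lia)) as Ho.
    replace (n - (i + l))%nat with (n - i - l)%nat in Ho by lia.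
    pose proof (INR_fact_neq_0 l). pose proof (INR_fact_neq_0 (n - i - l)) as Pz.
    pose proof (poch_neq0 b (i + l) Hb). pose proof (poch_neq0 c (i + l) Hc).
    apply Rmult_eq_reg_r with (INR (fact (n - i - l))); [|auto].
    transitivity ((poch (- INR n) (i + l) * INR (fact (n - i - l))) * poch a (i + l)
   / (poch b (i + l) * poch c (i + l))
   * (poch (- (1 / 2)) i * poch (1 - s - INR n) i * poch (2 * s + INR n - 1 / 2) l
   / (poch s i * INR (fact i) * INR (fact l)))); [field; auto|].
    rewrite Ho, poch_plus, pow_add. field. repeat split; auto.
  + apply Rmult_eq_reg_r with (poch s (n - i)); [|auto].
    transitivity ((-1) ^ i * INR (fact n) * poch a i * poch (- (1 / 2)) i
     * (poch (1 - s - INR n) i * poch s (n - i)) / (poch s i * INR (fact i))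
     * (poch (b - a) (n - i) * poch (c - a) (n - i)
    / (INR (fact (n - i)) * poch b n * poch c n))); [field; auto|].
    rewrite Hr.
    pose proof (sign_sqr i) as Hs2.
    transitivity (((-1) ^ i * (-1) ^ i) * INR (fact n) * poch a i * poch (- (1 / 2)) i
     * poch s n / (poch s i * INR (fact i))
     * (poch (b - a) (n - i) * poch (c - a) (n - i)
    / (INR (fact (n - i)) * poch b n * poch c n))); [field; auto|].
    rewrite Hs2. field. repeat split; auto.
Qed.

(** * Inversion and the expansion in squares of Bessel functions *)

(* The classical weight [(2 s + 2 n - 1) (2 s - 1)_{n+j} / (2 s - 1)]; the separate
   case [n = 0] covers [2 s = 1]. *)
Definition inv_weight (s : R) (n j : nat) : R :=
  match n with
  | O => 1
  | S m => (2 * s + 2 * INR m + 1) * poch (2 * s) (m + j)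
  end.

Lemma inv_weight_diag (s : R) (j : nat) : inv_weight s j j = poch (2 * s) (2 * j).
Proof.
destruct j as [|j]; [reflexivity|]. unfold inv_weight.
replace (2 * S j)%nat with (S (j + S j)) by lia. cbn [pochhammer].
rewrite plus_INR, S_INR. ring.
Qed.

(** A Gosper-type closed form of the partial sums. The factor [INR (K - M)] is left uncancelled
    against [fact (K - M)] so that the full sum M = K visibly vanishes. *)
Lemma orth_partial (s : R) (j K M : nat) : 0 < s -> (M <= K)%nat -> (1 <= K)%nat ->
  sum (fun m => (-1) ^ m * inv_weight s (j + m) j
     / (INR (fact m) * INR (fact (K - m)) * poch (2 * s) (K + 2 * j + m))) M
  = (-1) ^ M * INR (K - M) / (INR K * INR (fact M) * INR (fact (K - M)))
    * (poch (2 * s) (2 * j + M) / poch (2 * s) (K + 2 * j + M)).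
Proof.
intros Hs HM HK. pose proof (lt_0_INR K ltac:(lia)) as PK.
induction M as [|M IH].
- cbn [sum_f_R0]. rewrite !Nat.add_0_r, !Nat.sub_0_r, inv_weight_diag.
  pose proof (INR_fact_neq_0 K). pose proof (poch_neq0 (2 * s) (K + 2 * j) ltac:(lra)).
  simpl. field. repeat split; auto; lra.
- rewrite tech5, IH by lia. clear IH.
  destruct (Nat.le_exists_sub _ _ HM) as [r [-> _]].
  replace (r + S M - M)%nat with (S r) by lia.
  replace (r + S M - S M)%nat with r by lia.
  replace (j + S M)%nat with (S (j + M)) by lia. unfold inv_weight.
  rewrite !Nat.add_succ_r.
  replace (j + M + j)%nat with (2 * j + M)%nat by lia. cbn [pochhammer].
  set (X := poch (2 * s) (2 * j + M)).
  pose proof (poch_neq0 (2 * s) (S (r + M) + 2 * j + M) ltac:(lra)) as PQ.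
  set (Q := poch (2 * s) (S (r + M) + 2 * j + M)) in *.
  pose proof (INR_fact_lt_0 M). pose proof (INR_fact_lt_0 r).
  pose proof (pos_INR M). pose proof (pos_INR r). pose proof (pos_INR j).
  rewrite !fact_S_INR. clear PK.
  repeat rewrite ?S_INR, ?plus_INR, ?mult_INR. simpl (INR 0).
  simpl ((-1) ^ S M). field. repeat split; auto; lra.
Qed.

Lemma orth (s : R) (j K : nat) : 0 < s ->
  sum (fun m => (-1) ^ m * inv_weight s (j + m) j
     / (INR (fact m) * INR (fact (K - m)) * poch (2 * s) (K + 2 * j + m))) K
  = if Nat.eqb K 0 then 1 else 0.
Proof.
intros Hs. destruct K as [|K].
- cbn [sum_f_R0]. rewrite !Nat.add_0_r, inv_weight_diag. simpl (0 + 2 * j)%nat.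
  pose proof (poch_neq0 (2 * s) (2 * j) ltac:(lra)). simpl. field. auto.
- rewrite orth_partial by (auto; lia). rewrite Nat.sub_diag. simpl (INR 0).
  simpl. unfold Rdiv. ring.
Qed.

(** An inverse pair of triangular matrices: after the exchange of summations the coefficient of
    [beta j] is the sum in [orth] with K = k - j. *)
Lemma inversion (s : R) (beta : nat -> R) (k : nat) : 0 < s ->
  sum (fun n => sum (fun j => (-1) ^ (n - j) * inv_weight s n j / INR (fact (n - j))
      * beta j) n / (INR (fact (k - n)) * poch (2 * s) (k + n))) k
  = beta k.
Proof.
intros Hs.
set (f := fun j m => (-1) ^ m * inv_weight s (j + m) j / INR (fact m) * beta j
   / (INR (fact (k - (j + m))) * poch (2 * s) (k + (j + m)))).
transitivity (sum (fun n => sum (fun j => f j (n - j)%nat) n) k).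
- apply sum_eq. intros n Hn. unfold Rdiv at 1. rewrite Rmult_comm, scal_sum.
  apply sum_eq. intros j Hj. unfold f. replace (j + (n - j))%nat with n by lia. reflexivity.
- rewrite sum_exchange.
  rewrite (sum_eq _ (fun j => (if Nat.eqb (k - j) 0 then 1 else 0) * beta j)).
  + destruct k as [|k]; [simpl; ring|]. rewrite tech5, Nat.sub_diag.
    rewrite sum_eq_R0; [simpl; ring|]. intros j Hj.
    replace (S k - j)%nat with (S (k - j)) by lia. simpl; ring.
  + intros j Hj. rewrite <- (orth s j (k - j) Hs), Rmult_comm, scal_sum.
    apply sum_eq. intros m Hm. unfold f.
    replace (k - (j + m))%nat with (k - j - m)%nat by lia.
    replace (k - j + 2 * j + m)%nat with (k + (j + m))%nat by lia.
    pose proof (INR_fact_neq_0 m). pose proof (INR_fact_neq_0 (k - j - m)).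
    pose proof (poch_neq0 (2 * s) (k + (j + m)) ltac:(lra)). field. auto.
Qed.

(* Taylor coefficients, in [- W], of the square of [0F1 (; s + n + 1/2; - W / 4)]. *)
Definition sq_coeff (s : R) (n m : nat) : R :=
  poch (s + INR n) m
  / (INR (fact m) * poch (s + INR n + 1 / 2) m * poch (2 * s + 2 * INR n) m).

(* The 4F3 in Gasper's formula is [whipple_lhs]; the prefactor is split at [n = 0]
   for the same reason as in [inv_weight]. *)
Definition gasper_coeff (a b c s : R) (n : nat) : R :=
  match n with
  | O => 1
  | S m => (2 * s + 2 * INR m + 1) * poch (2 * s) m / INR (fact n)
      * whipple_lhs a b c s n
      * poch s n / (poch (s + 1 / 2) n * poch (2 * s) (2 * n))
  end.

(** Up to the factor (s)_k / (s + 1/2)_k the coefficient is a sequence [beta] whose inverse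
    transform is the 4F3. Splitting that factor and (2 s)_(k+n) at the index n leaves [sq_coeff]. *)
Lemma gasper_expansion (a b c s : R) (k : nat) : 0 < b -> 0 < c -> 0 < s ->
  hyp1F2_coeff a b c k
  = sum (fun n => (-1) ^ n * gasper_coeff a b c s n * sq_coeff s n (k - n)) k.
Proof.
intros Hb Hc Hs.
set (beta := fun j => poch a j * poch (s + 1 / 2) j
  / (INR (fact j) * poch b j * poch c j * poch s j)).
assert (Hs' : 0 < s + 1 / 2) by lra. assert (H2s : 0 < 2 * s) by lra.
transitivity (poch s k / poch (s + 1 / 2) k * beta k).
{ unfold hyp1F2_coeff, beta. pose proof (poch_neq0 _ k Hb). pose proof (poch_neq0 _ k Hc).
  pose proof (poch_neq0 _ k Hs). pose proof (poch_neq0 _ k Hs').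
  pose proof (INR_fact_neq_0 k). field. auto. }
rewrite <- (inversion s beta k Hs), scal_sum. apply sum_eq. intros n Hn.
assert (HD : sum (fun j => (-1) ^ (n - j) * inv_weight s n j / INR (fact (n - j)) * beta j) n
  = (-1) ^ n * gasper_coeff a b c s n * (poch (s + 1 / 2) n * poch (2 * s) (2 * n)) / poch s n).
{ destruct n as [|n].
  - unfold beta. simpl. field.
  - unfold gasper_coeff, whipple_lhs.
    pose proof (poch_neq0 _ (S n) Hs). pose proof (poch_neq0 _ (S n) Hs').
    pose proof (poch_neq0 _ (2 * S n) H2s). pose proof (INR_fact_neq_0 (S n)).
    transitivity ((-1) ^ S n * ((2 * s + 2 * INR n + 1) * poch (2 * s) n / INR (fact (S n)))
      * sum (fun j => poch (- INR (S n)) j * poch (2 * s + INR (S n) - 1) j * poch a j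
     * poch (s + 1 / 2) j
     / (INR (fact j) * poch b j * poch c j * poch s j)) (S n)).
    2: { field. auto. }
    rewrite scal_sum. apply sum_eq. intros j Hj. unfold inv_weight, beta.
    rewrite poch_plus.
    replace (2 * s + INR (S n) - 1) with (2 * s + INR n) by (rewrite S_INR; ring).
    pose proof (poch_opp (S n) j Hj) as Ho.
    pose proof (poch_neq0 _ j Hb). pose proof (poch_neq0 _ j Hc).
    pose proof (poch_neq0 _ j Hs). pose proof (INR_fact_neq_0 j).
    pose proof (INR_fact_neq_0 (S n - j)).
    replace (poch (- INR (S n)) j) with ((-1) ^ j * INR (fact (S n)) / INR (fact (S n - j)))
      by (rewrite <- Ho; field; auto).
    replace ((-1) ^ S n) with ((-1) ^ (S n - j) * (-1) ^ j)
      by (rewrite <- pow_add; f_equal; lia).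
    pose proof (sign_sqr j) as Hs2.
    match goal with |- ?L = _ => replace L with (L * ((-1) ^ j * (-1) ^ j)) by (rewrite Hs2; ring) end.
    field. repeat split; auto. }
rewrite HD. unfold sq_coeff.
pose proof (poch_plus s n (k - n)) as E1.
pose proof (poch_plus (s + 1 / 2) n (k - n)) as E2.
pose proof (poch_plus (2 * s) (2 * n) (k - n)) as E3.
replace (n + (k - n))%nat with k in * by lia.
replace (2 * n + (k - n))%nat with (k + n)%nat in E3 by lia.
rewrite mult_INR in E3. change (INR 2) with 2 in E3.
replace (s + 1 / 2 + INR n) with (s + INR n + 1 / 2) in E2 by ring.
rewrite E1, E2, E3. pose proof (pos_INR n).
pose proof (poch_neq0 s n Hs). pose proof (poch_neq0 _ n Hs'). pose proof (poch_neq0 _ (2 * n) H2s).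
pose proof (poch_neq0 (s + INR n + 1 / 2) (k - n) ltac:(lra)).
pose proof (poch_neq0 (2 * s + 2 * INR n) (k - n) ltac:(lra)).
pose proof (INR_fact_neq_0 (k - n)). field. repeat split; auto.
Qed.

(** * The square of a Bessel series *)

Lemma poch_double (x : R) (m : nat) :
  poch (2 * x) (2 * m) = 4 ^ m * (poch x m * poch (x + 1 / 2) m).
Proof.
induction m as [|m IH]; [simpl; ring|].
replace (2 * S m)%nat with (S (S (2 * m))) by lia. cbn [pochhammer pow].
rewrite IH, S_INR, mult_INR. simpl (INR 2). field.
Qed.

Lemma poch_falling (x : R) (m i : nat) : (i <= m)%nat ->
  poch (x + INR i) (m - i) = (-1) ^ (m - i) * poch (1 - x - INR m) (m - i).
Proof.
intros Hi. pose proof (poch_reflect (x + INR i) (m - i) (m - i) (Nat.le_refl _)) as H.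
rewrite Nat.sub_diag, minus_INR in H by lia.
replace (1 - (x + INR i) - (INR m - INR i)) with (1 - x - INR m) in H by ring.
cbn [pochhammer] in H. rewrite Rmult_1_r in H. rewrite H, <- Rmult_assoc, <- Rpow_mult_distr.
replace (-1 * -1) with 1 by ring. rewrite pow1. ring.
Qed.

(** Reversal turns 1 / ((t)_i (t)_(m-i)) into a multiple of (1 - t - m)_i (1 - t - m)_(m-i), so this
    is Vandermonde with both arguments 1 - t - m. Duplication of (2 t - 1)_(2m) produces the power
    of 4. *)
Lemma sq_coeff_conv (t : R) (m : nat) : 1 / 2 < t ->
  sum (fun i => / (INR (fact i) * poch t i) * / (INR (fact (m - i)) * poch t (m - i))) m
  = 4 ^ m * (poch (t - 1 / 2) m / (INR (fact m) * poch t m * poch (2 * t - 1) m)).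
Proof.
intros Ht.
assert (H0 : 0 < t) by lra. assert (H1 : 0 < 2 * t - 1) by lra.
pose proof (vandermonde (1 - t - INR m) (1 - t - INR m) m) as H.
pose proof (poch_neq0 _ m H0) as Pt. pose proof (poch_neq0 _ m H1) as P2.
pose proof (INR_fact_neq_0 m) as Pm.
assert (HR : rp (1 - t - INR m + (1 - t - INR m)) m
  = (-1) ^ m * (4 ^ m * (poch (t - 1 / 2) m * poch t m) / (poch (2 * t - 1) m * INR (fact m)))).
{ unfold rp.
  pose proof (poch_reflect (2 * t - 1 + INR m) m m (Nat.le_refl m)) as E.
  rewrite Nat.sub_diag, Rmult_1_r in E.
  replace (1 - (2 * t - 1 + INR m) - INR m) with (1 - t - INR m + (1 - t - INR m)) in E by ring.
  rewrite E. pose proof (poch_plus (2 * t - 1) m m) as E2.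
  replace (m + m)%nat with (2 * m)%nat in E2 by lia.
  replace (2 * t - 1) with (2 * (t - 1 / 2)) in E2 at 1 by field.
  rewrite poch_double in E2. replace (t - 1 / 2 + 1 / 2) with t in E2 by field.
  rewrite E2. field. auto. }
rewrite HR in H.
transitivity ((-1) ^ m / (poch t m * poch t m) *
 ((-1) ^ m * (4 ^ m * (poch (t - 1 / 2) m * poch t m) / (poch (2 * t - 1) m * INR (fact m))))).
2: { pose proof (sign_sqr m) as Hs2.
     match goal with |- _ = ?L => replace L with (L * ((-1) ^ m * (-1) ^ m)) by (rewrite Hs2; ring) end.
     field. auto. }
rewrite <- H, scal_sum. apply sum_eq. intros i Hi. unfold rp.
pose proof (poch_falling t m i Hi) as E1.
pose proof (poch_falling t m (m - i) ltac:(lia)) as E2.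
replace (m - (m - i))%nat with i in E2 by lia.
pose proof (poch_plus t i (m - i)) as F1. replace (i + (m - i))%nat with m in F1 by lia.
pose proof (poch_plus t (m - i) i) as F2. replace (m - i + i)%nat with m in F2 by lia.
rewrite E1 in F1. rewrite E2 in F2.
pose proof (poch_neq0 _ i H0). pose proof (poch_neq0 _ (m - i) H0).
pose proof (INR_fact_neq_0 i). pose proof (INR_fact_neq_0 (m - i)).
assert (Hs2 : (-1) ^ m = (-1) ^ i * (-1) ^ (m - i)) by (rewrite <- pow_add; f_equal; lia).
assert (Z : (-1) ^ m * (poch (1 - t - INR m) i * poch (1 - t - INR m) (m - i)) * (poch t i * poch t (m - i))
  = poch t m * poch t m).
{ rewrite F1 at 1. rewrite F2, Hs2. ring. }


transitivity (((-1) ^ m * (poch (1 - t - INR m) i * poch (1 - t - INR m) (m - i))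
    * (poch t i * poch t (m - i)) / (poch t m * poch t m))
  / (INR (fact i) * poch t i * (INR (fact (m - i)) * poch t (m - i))));
  [rewrite Z|]; field; repeat split; auto.
Qed.

(** * Sign of the Whipple sum *)

Lemma neg_half_poch_neg (k : nat) : 0 < - poch (- (1 / 2)) (S k).
Proof.
rewrite poch_S_l. replace (- (1 / 2) + 1) with (1 / 2) by field.
pose proof (pochhammer_pos (1 / 2) k ltac:(lra)). lra.
Qed.

(** The positive part of a summand of [whipple_rhs]; the binomial coefficient and the sign are in
    [whipple_wt], which does not depend on the parameters. *)
Definition whipple_term (a p q s : R) (n i : nat) : R :=
  poch a i / poch s i * (poch p (n - i) * poch q (n - i) / poch s (n - i)).

(** The quotient (x + m)_i / (x)_i decreases in x, being a product of factors 1 + m / (x + j). *)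
Lemma poch_cross_le (x y : R) (m i : nat) : 0 < x <= y ->
  poch (y + INR m) i * poch x i <= poch (x + INR m) i * poch y i.
Proof.
intros H. pose proof (pos_INR m) as Pm. induction i as [|i IH]; [simpl; lra|].
cbn [pochhammer]. pose proof (pos_INR i) as Pi.
replace (poch (y + INR m) i * (y + INR m + INR i) * (poch x i * (x + INR i)))
  with (poch (y + INR m) i * poch x i * ((y + INR m + INR i) * (x + INR i))) by ring.
replace (poch (x + INR m) i * (x + INR m + INR i) * (poch y i * (y + INR i)))
  with (poch (x + INR m) i * poch y i * ((x + INR m + INR i) * (y + INR i))) by ring.
apply Rmult_le_compat; [| |exact IH|].
- apply Rmult_le_pos; apply Rlt_le, pochhammer_pos; lra.
- apply Rmult_le_pos; lra.
- nra.
Qed.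

(** Factor by factor: (x + u) (y + u) = x y + (x + y) u + u^2 increases with the sum and the product
    of the pair when u >= 0. *)
Lemma poch_pair_le (p q x y m : R) (i : nat) :
  0 < p -> 0 < q -> 0 < x -> 0 < y -> 0 <= m -> x + y <= p + q -> x * y <= p * q ->
  poch (x + m) i * poch (y + m) i <= poch (p + m) i * poch (q + m) i.
Proof.
intros Hp Hq Hx Hy Hm Hs Hpr. induction i as [|i IH]; [simpl; lra|].
cbn [pochhammer]. pose proof (pos_INR i) as Pi.
replace (poch (x + m) i * (x + m + INR i) * (poch (y + m) i * (y + m + INR i)))
  with (poch (x + m) i * poch (y + m) i * ((x + m + INR i) * (y + m + INR i))) by ring.
replace (poch (p + m) i * (p + m + INR i) * (poch (q + m) i * (q + m + INR i)))
  with (poch (p + m) i * poch (q + m) i * ((p + m + INR i) * (q + m + INR i))) by ring.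
apply Rmult_le_compat; [| |exact IH|].
- apply Rmult_le_pos; apply Rlt_le, pochhammer_pos; lra.
- apply Rmult_le_pos; lra.
- assert (0 <= m + INR i) by lra. set (u := m + INR i) in *.
  replace ((x + m + INR i) * (y + m + INR i)) with (x * y + (x + y) * u + u * u) by (unfold u; ring).
  replace ((p + m + INR i) * (q + m + INR i)) with (p * q + (p + q) * u + u * u) by (unfold u; ring).
  assert ((x + y) * u <= (p + q) * u) by (apply Rmult_le_compat_r; lra). lra.
Qed.

(* The case of equality, at the points of [S_a]. *)
Lemma whipple_rhs_ref (a : R) (n : nat) : 0 < a ->
  whipple_rhs a a (1 / 2) a (S n) = 0.
Proof.
intros Ha. unfold whipple_rhs.
pose proof (vandermonde (- (1 / 2)) (1 / 2) (S n)) as H.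
assert (E : rp 0 (S n) = 0)
  by (unfold rp; rewrite poch_S_l; unfold Rdiv; ring).
rewrite Rplus_opp_l, E in H.
rewrite <- (Rmult_0_r (INR (fact (S n)))), <- H, scal_sum.
apply sum_eq. intros i Hi. unfold rp.
pose proof (INR_fact_neq_0 i). pose proof (INR_fact_neq_0 (S n - i)).
pose proof (poch_neq0 _ i Ha). pose proof (poch_neq0 _ (S n - i) Ha).
field. auto.
Qed.

(** Term i relative to term 0 is compared at (p, q, s) and at the reference point (a, 1/2, a). After
    cross multiplication and removal of a common factor, what remains is one instance of
    [poch_cross_le] (s against a) times one of [poch_pair_le]. *)
Lemma whipple_term_cross (a p q s : R) (m i : nat) :
  0 < a <= s -> 0 < p -> 0 < q ->
  exists T, 0 < T /\
  whipple_term a p q s (m + i) i * whipple_term a a (1 / 2) a (m + i) 0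
    = T * ((poch (s + INR m) i * poch a i)
           * (poch (a + INR m) i * poch (1 / 2 + INR m) i)) /\
  whipple_term a a (1 / 2) a (m + i) i * whipple_term a p q s (m + i) 0
    = T * ((poch (a + INR m) i * poch s i)
           * (poch (p + INR m) i * poch (q + INR m) i)).
Proof.
intros Ha Hp Hq. unfold whipple_term.
rewrite Nat.sub_0_r, Nat.add_sub, !poch_plus.
assert (Hh : 0 < 1 / 2) by lra. pose proof (pos_INR m) as Pm.
pose proof (pochhammer_pos a i ltac:(lra)). pose proof (pochhammer_pos s i ltac:(lra)).
pose proof (pochhammer_pos a m ltac:(lra)). pose proof (pochhammer_pos s m ltac:(lra)).
pose proof (pochhammer_pos p m Hp). pose proof (pochhammer_pos q m Hq).
pose proof (pochhammer_pos _ m Hh).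
pose proof (pochhammer_pos (a + INR m) i ltac:(lra)).
pose proof (pochhammer_pos (s + INR m) i ltac:(lra)).
simpl (poch _ 0).
exists (poch p m * poch q m * poch (1 / 2) m
  / (poch s m * poch s i * poch (s + INR m) i * poch (a + INR m) i)).
split; [apply Rdiv_lt_0_compat; repeat apply Rmult_lt_0_compat; auto|].
split; field; repeat split; lra.
Qed.

Lemma whipple_term_le (a p q s : R) (n i : nat) :
  0 < a <= s -> 0 < p -> 0 < q -> a + 1 / 2 <= p + q -> a / 2 <= p * q -> (i <= n)%nat ->
  whipple_term a p q s n i * whipple_term a a (1 / 2) a n 0
  <= whipple_term a a (1 / 2) a n i * whipple_term a p q s n 0.
Proof.
intros Ha Hp Hq Hs Hpq Hi.
destruct (Nat.le_exists_sub _ _ Hi) as [m [-> _]]. pose proof (pos_INR m) as Pm.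
destruct (whipple_term_cross a p q s m i Ha Hp Hq) as [T [HT [-> ->]]].
apply Rmult_le_compat_l; [lra|]. apply Rmult_le_compat.
- apply Rmult_le_pos; apply Rlt_le, pochhammer_pos; lra.
- apply Rmult_le_pos; apply Rlt_le, pochhammer_pos; lra.
- apply poch_cross_le, Ha.
- apply poch_pair_le; lra.
Qed.

(** The order n >= 2 makes the shift u = n - 1 positive, so that the sum p + q counts. For n = 1
    only the product p q would enter, and equality is possible off S_a. *)
Lemma whipple_term_lt (a p q s : R) (m : nat) :
  0 < a <= s -> 0 < p -> 0 < q -> a + 1 / 2 <= p + q -> a / 2 <= p * q ->
  a + 1 / 2 < p + q \/ a / 2 < p * q ->
  whipple_term a p q s (S (S m)) 1 * whipple_term a a (1 / 2) a (S (S m)) 0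
  < whipple_term a a (1 / 2) a (S (S m)) 1 * whipple_term a p q s (S (S m)) 0.
Proof.
intros Ha Hp Hq Hs Hpq Hst.
destruct (whipple_term_cross a p q s (S m) 1 Ha Hp Hq) as [T [HT [H1 H2]]].
replace (S m + 1)%nat with (S (S m)) in * by lia. rewrite H1, H2.
apply Rmult_lt_compat_l; [exact HT|].
pose proof (poch_cross_le a s (S m) 1 Ha) as C1. rewrite S_INR in *.
pose proof (pos_INR m) as Pm. simpl in *. rewrite !Rplus_0_r, !Rmult_1_l in *.
assert (E : (a + (INR m + 1)) * (1 / 2 + (INR m + 1)) < (p + (INR m + 1)) * (q + (INR m + 1))).
{ set (u := INR m + 1). assert (1 <= u) by (unfold u; lra).
  replace ((a + u) * (1 / 2 + u)) with (a / 2 + (a + 1 / 2) * u + u * u) by field.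
  replace ((p + u) * (q + u)) with (p * q + (p + q) * u + u * u) by ring.
  destruct Hst; nra. }
apply Rle_lt_trans with ((a + (INR m + 1)) * s * ((a + (INR m + 1)) * (1 / 2 + (INR m + 1)))).
- apply Rmult_le_compat_r; [|exact C1]. apply Rmult_le_pos; lra.
- apply Rmult_lt_compat_l; [apply Rmult_lt_0_compat; lra | exact E].
Qed.

Definition whipple_wt (n i : nat) : R :=
  INR (fact n) / (INR (fact i) * INR (fact (n - i))) * poch (- (1 / 2)) i.

Lemma whipple_rhs_split (a p q s : R) (n : nat) :
  whipple_rhs a p q s n = sum (fun i => whipple_wt n i * whipple_term a p q s n i) n.
Proof.
unfold whipple_rhs. apply sum_eq. intros i Hi. unfold whipple_wt, whipple_term. ring.
Qed.

Lemma whipple_wt_neg (n i : nat) : whipple_wt n (S i) < 0.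
Proof.
unfold whipple_wt. pose proof (neg_half_poch_neg i).
assert (0 < INR (fact n) / (INR (fact (S i)) * INR (fact (n - S i)))).
{ apply Rdiv_lt_0_compat; [|apply Rmult_lt_0_compat]; apply INR_fact_lt_0. }
nra.
Qed.

Lemma whipple_wt_0 (n : nat) : whipple_wt n 0 = 1.
Proof.
unfold whipple_wt. rewrite Nat.sub_0_r. simpl. field. apply INR_fact_neq_0.
Qed.

Lemma whipple_term_pos (a p q s : R) (n i : nat) : 0 < a -> 0 < p -> 0 < q -> 0 < s ->
  0 < whipple_term a p q s n i.
Proof.
intros. unfold whipple_term.
repeat first [apply pochhammer_pos | apply Rdiv_lt_0_compat | apply Rmult_lt_0_compat]; auto.
Qed.

Lemma whipple_rhs_le (a p q s : R) (n : nat) : 0 < a -> 0 < p -> 0 < q -> 0 < s ->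
  whipple_rhs a p q s n <= poch p n * poch q n / poch s n.
Proof.
intros Ha Hp Hq Hs. rewrite whipple_rhs_split.
assert (E : whipple_wt n 0 * whipple_term a p q s n 0 = poch p n * poch q n / poch s n).
{ rewrite whipple_wt_0. unfold whipple_term. rewrite Nat.sub_0_r. simpl (poch _ 0).
  field. apply poch_neq0, Hs. }
rewrite <- E. destruct n as [|n]; [simpl; lra|].
rewrite decomp_sum by lia. simpl pred.
enough (sum (fun i => whipple_wt (S n) (S i) * whipple_term a p q s (S n) (S i)) n <= 0) by lra.
rewrite <- (Rmult_0_l (INR (S n))), <- sum_cte. apply sum_Rle. intros i Hi.
pose proof (whipple_wt_neg (S n) i).
pose proof (whipple_term_pos a p q s (S n) (S i) Ha Hp Hq Hs). nra.
Qed.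

(** The sum and the reference sum are scaled to the same first summand. All other weights are
    negative, so [whipple_term_le] puts the sum above the reference sum, which is 0. *)
Lemma whipple_rhs_nonneg (a p q s : R) (n : nat) :
  0 < a <= s -> 0 < p -> 0 < q -> a + 1 / 2 <= p + q -> a / 2 <= p * q ->
  0 <= whipple_rhs a p q s n.
Proof.
intros Ha Hp Hq Hs Hpq. destruct n as [|n]; [unfold whipple_rhs; simpl; lra|].
assert (H : 0 < a) by lra. assert (H' : 0 < s) by lra. assert (Hh : 0 < 1 / 2) by lra.
pose proof (whipple_term_pos a a (1 / 2) a (S n) 0 H H Hh H) as T0.
apply Rmult_le_reg_r with (1 := T0). rewrite Rmult_0_l.
rewrite <- (Rmult_0_l (whipple_term a p q s (S n) 0)), <- (whipple_rhs_ref a n H).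
rewrite !whipple_rhs_split, !(Rmult_comm (sum _ _)), !scal_sum.
apply sum_Rle. intros i Hi.
pose proof (whipple_term_le a p q s (S n) i Ha Hp Hq Hs Hpq Hi).
destruct i as [|i]; [rewrite whipple_wt_0; lra|].
pose proof (whipple_wt_neg (S n) i). nra.
Qed.

Lemma sum_lt_one (f g : nat -> R) (n k : nat) : (k <= n)%nat ->
  (forall i, (i <= n)%nat -> f i <= g i) -> f k < g k -> sum f n < sum g n.
Proof.
intros Hk Hle Hlt. induction n as [|n IH].
- replace k with 0%nat in Hlt by lia. exact Hlt.
- rewrite !tech5. destruct (Nat.eq_dec k (S n)) as [->|Hne].
  + apply Rplus_le_lt_compat; [|exact Hlt]. apply sum_Rle. auto.
  + apply Rplus_lt_le_compat; [apply IH; auto; lia | auto].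
Qed.

Lemma whipple_rhs_pos (a p q s : R) (n : nat) :
  0 < a <= s -> 0 < p -> 0 < q -> a + 1 / 2 <= p + q -> a / 2 <= p * q ->
  a + 1 / 2 < p + q \/ a / 2 < p * q -> 0 < whipple_rhs a p q s (S (S n)).
Proof.
intros Ha Hp Hq Hs Hpq Hst.
assert (H : 0 < a) by lra. assert (H' : 0 < s) by lra. assert (Hh : 0 < 1 / 2) by lra.
pose proof (whipple_term_pos a a (1 / 2) a (S (S n)) 0 H H Hh H) as T0.
apply Rmult_lt_reg_r with (1 := T0). rewrite Rmult_0_l.
rewrite <- (Rmult_0_l (whipple_term a p q s (S (S n)) 0)), <- (whipple_rhs_ref a (S n) H).
rewrite !whipple_rhs_split, !(Rmult_comm (sum _ _)), !scal_sum.
apply sum_lt_one with 1%nat; [lia| |].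
- intros i Hi. pose proof (whipple_term_le a p q s (S (S n)) i Ha Hp Hq Hs Hpq Hi).
  destruct i as [|i]; [rewrite whipple_wt_0; lra|].
  pose proof (whipple_wt_neg (S (S n)) i). nra.
- pose proof (whipple_term_lt a p q s n Ha Hp Hq Hs Hpq Hst).
  pose proof (whipple_wt_neg (S (S n)) 0). nra.
Qed.

(** * Positivity on the real line *)

Lemma is_series_lim (u : nat -> R) (l : R) : is_series u l -> is_lim_seq (sum u) l.
Proof.
intros H. apply is_lim_seq_ext with (sum_n u); [|exact H].
intros n. apply sum_n_Reals.
Qed.

Lemma series_tail (x y : nat -> R) (X Y : R) (M : nat) :
  is_series x X -> is_series y Y -> (forall k, Rabs (x k) <= y k) ->
  Rabs (X - sum x M) <= Y - sum y M.
Proof.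
intros Hx Hy Hle. apply is_series_lim in Hx. apply is_series_lim in Hy.
assert (HN : forall n, Rabs (sum x (n + M) - sum x M) <= sum y (n + M) - sum y M).
{ induction n as [|n IH].
  - simpl. rewrite !Rminus_diag, Rabs_R0. lra.
  - simpl. pose proof (Hle (S (n + M))).
    replace (sum x (n + M) + x (S (n + M)) - sum x M)
      with (sum x (n + M) - sum x M + x (S (n + M))) by ring.
    pose proof (Rabs_triang (sum x (n + M) - sum x M) (x (S (n + M)))). lra. }
apply (is_lim_seq_incr_n _ M) in Hx. apply (is_lim_seq_incr_n _ M) in Hy.
assert (L1 : is_lim_seq (fun n => Rabs (sum x (n + M) - sum x M)) (Rabs (X - sum x M))).
{ apply (is_lim_seq_abs _ (X - sum x M)).
  apply is_lim_seq_minus'; [exact Hx | apply is_lim_seq_const]. }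
assert (L2 : is_lim_seq (fun n => sum y (n + M) - sum y M) (Y - sum y M)).
{ apply is_lim_seq_minus'; [exact Hy | apply is_lim_seq_const]. }
exact (is_lim_seq_le _ _ (Finite _) (Finite _) HN L1 L2).
Qed.

Definition bessel_coeff (t : R) (k : nat) : R := / (INR (fact k) * poch t k).

Lemma bessel_coeff_pos (t : R) (k : nat) : 0 < t -> 0 < bessel_coeff t k.
Proof.
intros Ht. apply Rinv_0_lt_compat, Rmult_lt_0_compat;
  [apply INR_fact_lt_0 | now apply pochhammer_pos].
Qed.

Lemma poch_ge_pow (t x : R) (k : nat) : 0 < x <= t -> x ^ k <= poch t k.
Proof.
intros H. induction k as [|k IH]; simpl; [lra|]. rewrite Rmult_comm.
pose proof (pos_INR k). apply Rmult_le_compat; try lra. apply pow_le; lra.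
Qed.

Lemma bessel_coeff_le (t X : R) (k : nat) : 0 < t -> 0 <= X ->
  bessel_coeff t k * X ^ k <= / INR (fact k) * (X / t) ^ k.
Proof.
intros Ht HX. unfold bessel_coeff, Rdiv. rewrite Rpow_mult_distr, pow_inv, Rinv_mult.
pose proof (poch_ge_pow t t k ltac:(lra)) as H. pose proof (pow_lt t k Ht) as P.
pose proof (pow_le X k HX). pose proof (Rinv_0_lt_compat _ (INR_fact_lt_0 k)).
pose proof (Rinv_le_contravar _ _ P H).
rewrite Rmult_assoc. apply Rmult_le_compat_l; [lra|].
rewrite Rmult_comm. now apply Rmult_le_compat_l.
Qed.

Lemma is_series_exp (x : R) : is_series (fun k => / INR (fact k) * x ^ k) (exp x).
Proof. apply is_pseries_R, is_exp_Reals. Qed.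

Lemma bessel_coeff_abs_summable (t x : R) : 0 < t ->
  ex_series (fun k => Rabs (bessel_coeff t k * x ^ k)).
Proof.
intros Ht.
apply (@ex_series_le R_AbsRing R_CompleteNormedModule _
  (fun k => / INR (fact k) * (Rabs x / t) ^ k)); [|eexists; apply is_series_exp].
intros k. change (Rabs (Rabs (bessel_coeff t k * x ^ k)) <= / INR (fact k) * (Rabs x / t) ^ k).
rewrite Rabs_Rabsolu, Rabs_mult, <- RPow_abs, (Rabs_pos_eq (bessel_coeff t k));
  [|apply Rlt_le, bessel_coeff_pos, Ht].
apply bessel_coeff_le; [exact Ht | apply Rabs_pos].
Qed.

Lemma square_series (s W : R) (n : nat) : 0 < s ->
  exists J : R, is_series (fun k => bessel_coeff (s + INR n + 1 / 2) k * (- W / 4) ^ k) J /\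
    is_series (fun m => sq_coeff s n m * (- W) ^ m) (J * J).
Proof.
intros Hs. set (t := s + INR n + 1 / 2). pose proof (pos_INR n).
assert (Ht : 1 / 2 < t) by (unfold t; lra).
pose proof (bessel_coeff_abs_summable t (- W / 4) ltac:(lra)) as Ha.
pose proof (Series_correct _ (ex_series_Rabs _ Ha)) as HJ.
exists (Series (fun k => bessel_coeff t k * (- W / 4) ^ k)). split; [exact HJ|].
pose proof (is_series_mult _ _ _ _ HJ HJ Ha Ha) as H2.
eapply is_series_ext; [|exact H2]. intros m. cbv beta.
match goal with |- ?x = ?y => change (@eq R x y) end.
transitivity (sum (fun i => / (INR (fact i) * poch t i) * / (INR (fact (m - i)) * poch t (m - i))) m
   * (- W / 4) ^ m).
- rewrite Rmult_comm, scal_sum. apply sum_eq. intros i Hi. unfold bessel_coeff.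
  replace ((- W / 4) ^ m) with ((- W / 4) ^ i * (- W / 4) ^ (m - i)) by (rewrite <- pow_add; f_equal; lia).
  ring.
- rewrite sq_coeff_conv by exact Ht. unfold sq_coeff.
  replace (t - 1 / 2) with (s + INR n) by (unfold t; ring).
  replace (2 * t - 1) with (2 * s + 2 * INR n) by (unfold t; field). fold t.
  replace (- W) with (4 * (- W / 4)) at 2 by field. rewrite Rpow_mult_distr. ring.
Qed.

(** The bound is uniform in n: one convergent series dominates all the squares. *)
Lemma sq_coeff_bound (s : R) (n m : nat) : 0 < s -> 0 <= sq_coeff s n m <= bessel_coeff (2 * s) m.
Proof.
intros Hs. unfold sq_coeff, bessel_coeff. pose proof (pos_INR n).
pose proof (pochhammer_pos (s + INR n) m ltac:(lra)).
pose proof (pochhammer_pos (s + INR n + 1 / 2) m ltac:(lra)).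
pose proof (pochhammer_pos (2 * s + 2 * INR n) m ltac:(lra)).
pose proof (pochhammer_pos (2 * s) m ltac:(lra)).
pose proof (INR_fact_lt_0 m). pose proof (poch_le (s + INR n) (s + INR n + 1 / 2) m ltac:(lra)).
pose proof (poch_le (2 * s) (2 * s + 2 * INR n) m ltac:(lra)).
split.
- apply Rlt_le, Rdiv_lt_0_compat; [|repeat apply Rmult_lt_0_compat]; auto.
- apply Rle_trans with (poch (s + INR n + 1 / 2) m /
    (INR (fact m) * poch (s + INR n + 1 / 2) m * poch (2 * s + 2 * INR n) m)).
  + apply Rmult_le_compat_r; [|auto]. apply Rlt_le, Rinv_0_lt_compat.
    repeat apply Rmult_lt_0_compat; auto.
  + replace (poch (s + INR n + 1 / 2) m /
    (INR (fact m) * poch (s + INR n + 1 / 2) m * poch (2 * s + 2 * INR n) m))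
     with (/ (INR (fact m) * poch (2 * s + 2 * INR n) m)) by (field; lra).
    apply Rinv_le_contravar; [now apply Rmult_lt_0_compat|].
    apply Rmult_le_compat_l; lra.
Qed.

(** The terms after the leading 1 add up to at most exp (1/4) - 1 < 1. For given W this yields a
    non-zero square as soon as n is large. *)
Lemma bessel_series_pos (t W J : R) : 0 < t -> 0 <= W <= t ->
  is_series (fun k => bessel_coeff t k * (- W / 4) ^ k) J -> 0 < J.
Proof.
intros Ht HW HJ.
pose proof (series_tail _ _ _ _ 0 HJ (is_series_exp (W / 4 / t))) as H.
cbn [sum_f_R0] in H.
replace (bessel_coeff t 0 * (- W / 4) ^ 0) with 1 in H by (unfold bessel_coeff; simpl; field).
replace (/ INR (fact 0) * (W / 4 / t) ^ 0) with 1 in H by (simpl; field).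
assert (HX : exp (W / 4 / t) < 2).
{ apply Rle_lt_trans with (exp (1 / 4)).
  - assert (W / 4 / t <= 1 / 4).
    { apply Rle_div_l; lra. }
    destruct H0 as [H0|H0]; [left; now apply exp_increasing | rewrite H0; lra].
  - apply Rnot_le_lt. intros Hc2.
    assert (E : exp 1 = exp (1 / 4) * exp (1 / 4) * (exp (1 / 4) * exp (1 / 4)))
      by (rewrite <- !exp_plus; f_equal; field).
    pose proof exp_le_3. assert (4 <= exp (1 / 4) * exp (1 / 4)) by nra. nra. }
replace (- W / 4) with (- (W / 4)) in * by field.
assert (Hle : Rabs (J - 1) <= exp (W / 4 / t) - 1).
{ apply H. intros k. rewrite Rabs_mult, <- RPow_abs, Rabs_Ropp, (Rabs_pos_eq (bessel_coeff t k)),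
    (Rabs_pos_eq (W / 4)) by (try (apply Rlt_le, bessel_coeff_pos, Ht); lra).
  apply bessel_coeff_le; lra. }
apply Rabs_le_between in Hle. lra.
Qed.

Section Gasper.
Variables a b c s : R.
Hypothesis Ha : 0 < a <= s.
Hypothesis Hp : 0 < b - a.
Hypothesis Hq : 0 < c - a.
Hypothesis Hs : 2 * s = b + c - a - 1 / 2.
Hypothesis Hpq : a / 2 <= (b - a) * (c - a).

Let H0s : 0 < s. Proof. lra. Qed.
Let Hb : 0 < b. Proof. lra. Qed.
Let Hc : 0 < c. Proof. lra. Qed.

Lemma gasper_coeff_S (m : nat) :
  gasper_coeff a b c s (S m) =
  (2 * s + 2 * INR m + 1) * poch (2 * s) m / INR (fact (S m))
  * (poch s (S m) / (poch b (S m) * poch c (S m)))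
  * (poch s (S m) / (poch (s + 1 / 2) (S m) * poch (2 * s) (2 * S m)))
  * whipple_rhs a (b - a) (c - a) s (S m).
Proof. unfold gasper_coeff. rewrite whipple by assumption. unfold Rdiv. ring. Qed.

Lemma gasper_factor_pos (m : nat) :
  0 < (2 * s + 2 * INR m + 1) * poch (2 * s) m / INR (fact (S m))
  * (poch s (S m) / (poch b (S m) * poch c (S m)))
  * (poch s (S m) / (poch (s + 1 / 2) (S m) * poch (2 * s) (2 * S m))).
Proof.
pose proof (pos_INR m).
repeat first [apply pochhammer_pos | apply INR_fact_lt_0 | apply Rdiv_lt_0_compat
             | apply Rmult_lt_0_compat]; lra.
Qed.

Lemma gasper_coeff_nonneg (n : nat) : 0 <= gasper_coeff a b c s n.
Proof.
destruct n as [|m]; [simpl; lra|]. rewrite gasper_coeff_S.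
apply Rmult_le_pos; [apply Rlt_le, gasper_factor_pos|].
apply whipple_rhs_nonneg; lra.
Qed.

Lemma gasper_coeff_pos (m : nat) : 2 * a < 2 * s \/ a / 2 < (b - a) * (c - a) ->
  0 < gasper_coeff a b c s (S (S m)).
Proof.
intros Hst. rewrite gasper_coeff_S. apply Rmult_lt_0_compat; [apply gasper_factor_pos|].
apply whipple_rhs_pos; lra.
Qed.

(** The first summand of the Whipple sum bounds the whole, and the quotients that remain are at most
    1. The majorant is the one of [sq_coeff_bound], so the double series is dominated by the square
    of a single series. *)
Lemma gasper_coeff_le (n : nat) : gasper_coeff a b c s n <= bessel_coeff (2 * s) n.
Proof.
destruct n as [|m]; [unfold bessel_coeff; simpl; lra|]. rewrite gasper_coeff_S.
eapply Rle_trans.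
- apply Rmult_le_compat_l; [apply Rlt_le, gasper_factor_pos|].
  apply whipple_rhs_le; lra.
- set (n := S m). pose proof (poch_le (b - a) b n ltac:(lra)) as Lp.
  pose proof (poch_le (c - a) c n ltac:(lra)) as Lq.
  pose proof (poch_le s (s + 1 / 2) n ltac:(lra)) as Ls.
  pose proof (pochhammer_pos _ n Hb). pose proof (pochhammer_pos _ n Hc).
  pose proof (pochhammer_pos _ n Hp). pose proof (pochhammer_pos _ n Hq).
  pose proof (pochhammer_pos _ n H0s). pose proof (pochhammer_pos (s + 1 / 2) n ltac:(lra)).
  pose proof (pochhammer_pos (2 * s) m ltac:(lra)). pose proof (pochhammer_pos (2 * s) n ltac:(lra)).
  pose proof (pochhammer_pos (2 * s + INR m) n ltac:(pose proof (pos_INR m); lra)).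
  pose proof (INR_fact_lt_0 n). pose proof (pos_INR m).
  (* Since n = m + 1, (2 s)_(2n) contains the whole weight (2 s + 2 m + 1) (2 s)_m, which
     cancels. *)
  assert (E : poch (2 * s) (2 * n) = poch (2 * s) m * poch (2 * s + INR m) n * (2 * s + 2 * INR m + 1)).
  { replace (2 * n)%nat with (S (m + n)) by (unfold n; lia).
    change (poch (2 * s) (S (m + n))) with (poch (2 * s) (m + n) * (2 * s + INR (m + n))).
    rewrite poch_plus, plus_INR. unfold n. rewrite S_INR. ring. }
  rewrite E.
  pose proof (poch_le (2 * s) (2 * s + INR m) n ltac:(lra)) as L2.
  match goal with |- ?L <= _ =>
    replace L with ((poch (b - a) n / poch b n) * (poch (c - a) n / poch c n)
       * (poch s n / poch (s + 1 / 2) n) * / (INR (fact n) * poch (2 * s + INR m) n))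
    by (field; repeat split; lra) end.
  assert (Q1 : forall x y, 0 < x -> x <= y -> 0 <= x / y <= 1).
  { intros x y Hx Hxy. split; [apply Rlt_le, Rdiv_lt_0_compat; lra|].
    apply Rle_div_l; lra. }
  pose proof (Q1 _ _ H1 Lp). pose proof (Q1 _ _ H2 Lq). pose proof (Q1 _ _ H3 Ls).
  assert (L3 : / (INR (fact n) * poch (2 * s + INR m) n) <= bessel_coeff (2 * s) n).
  { unfold bessel_coeff. apply Rinv_le_contravar; [now apply Rmult_lt_0_compat|].
    apply Rmult_le_compat_l; lra. }
  assert (0 < / (INR (fact n) * poch (2 * s + INR m) n))
    by now apply Rinv_0_lt_compat, Rmult_lt_0_compat.
  assert (Q2 : forall x y, 0 <= x <= 1 -> 0 <= y <= 1 -> 0 <= x * y <= 1).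
  { intros x y Hx Hy. split; nra. }
  eapply Rle_trans; [|exact L3].
  rewrite <- (Rmult_1_l (/ _)) at 2. apply Rmult_le_compat_r; [lra|].
  apply Q2; [apply Q2|]; assumption.
Qed.

Lemma gasper_positive (W l : R) : 0 < W ->
  2 * a < 2 * s \/ a / 2 < (b - a) * (c - a) ->
  is_series (fun k => hyp1F2_coeff a b c k * (- W) ^ k) l -> 0 < l.
Proof.
intros HW Hst Hl.
set (v := fun k => bessel_coeff (2 * s) k * W ^ k).
pose proof (bessel_coeff_abs_summable (2 * s) W ltac:(lra)) as Hv.
pose proof (Series_correct _ (ex_series_Rabs _ Hv)) as HV. fold v in Hv, HV.
set (V := Series v) in HV.
assert (v0 : forall k, 0 <= v k).
{ intros k. apply Rmult_le_pos; [apply Rlt_le, bessel_coeff_pos; lra | apply pow_le; lra]. }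
destruct (nfloor_ex W ltac:(lra)) as [N HN].
(* At least 2, for a strictly positive coefficient, and at least W, for a positive Bessel value. *)
set (n0 := S (S N)).
destruct (square_series s W n0 H0s) as [J0 [HJ0 HE0]].
assert (PJ : 0 < J0).
{ apply (bessel_series_pos (s + INR n0 + 1 / 2) W); [| |exact HJ0].
  - pose proof (pos_INR n0). lra.
  - unfold n0. rewrite !S_INR. lra. }
set (D := gasper_coeff a b c s).
apply Rlt_le_trans with (D n0 * W ^ n0 * (J0 * J0)).
{ apply Rmult_lt_0_compat; [|nra].
  apply Rmult_lt_0_compat; [now apply gasper_coeff_pos | now apply pow_lt]. }
(* A Taylor partial sum runs over the triangle n + m <= K. Replacing each row by its full square
   costs at most v_n times a tail of v; the total cost is the difference between (sum of v up to K)
   V and the K-th partial sum of the Cauchy product of v with itself. *)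
assert (Hpart : forall K, (n0 <= K)%nat ->
  D n0 * W ^ n0 * (J0 * J0)
  - (sum v K * V - sum (fun k => sum (fun n => v n * v (k - n)%nat) k) K)
  <= sum (fun k => hyp1F2_coeff a b c k * (- W) ^ k) K).
{ intros K HK.
  rewrite (sum_eq (fun k => hyp1F2_coeff a b c k * (- W) ^ k)
    (fun k => sum (fun n => D n * W ^ n * (sq_coeff s n (k - n) * (- W) ^ (k - n))) k)).
  2:{ intros k Hk. rewrite (gasper_expansion a b c s) by assumption.
      rewrite Rmult_comm, scal_sum. apply sum_eq. intros n Hn. fold D.
      replace (- W) with (-1 * W) by ring. rewrite !Rpow_mult_distr.
      assert (E1 : W ^ k = W ^ n * W ^ (k - n)) by (rewrite <- pow_add; f_equal; lia).
      assert (E2 : (-1) ^ k = (-1) ^ n * (-1) ^ (k - n)) by (rewrite <- pow_add; f_equal; lia).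
      pose proof (sign_sqr n) as Hs2.
      rewrite E1, E2.
      transitivity (((-1) ^ n * (-1) ^ n) * (D n * W ^ n * sq_coeff s n (k - n) * (-1) ^ (k - n) * W ^ (k - n))); [ring|].
      rewrite Hs2. ring. }
  rewrite (sum_exchange (fun n m => D n * W ^ n * (sq_coeff s n m * (- W) ^ m))).
  rewrite (sum_exchange (fun n m => v n * v m)).
  (* E is the full square of row n; only the one at [n0] must be identified, the others are merely
     nonnegative. *)
  assert (HT : forall n, exists E, 0 <= E /\ (n = n0 -> E = J0 * J0) /\
     forall M, E - (V - sum v M) <= sum (fun m => sq_coeff s n m * (- W) ^ m) M).
  { intros n.
    assert (HE : exists E, 0 <= E /\ (n = n0 -> E = J0 * J0) /\
       is_series (fun m => sq_coeff s n m * (- W) ^ m) E).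
    { destruct (Nat.eq_dec n n0) as [->|Hne].
      - exists (J0 * J0). split; [nra|]. auto.
      - destruct (square_series s W n H0s) as [J [_ HJ]].
        exists (J * J). split; [nra|]. split; [tauto|exact HJ]. }
    destruct HE as [E [E0 [E1 E2]]]. exists E. split; [exact E0|]. split; [exact E1|].
    intros M.
    assert (Hb' : forall k, Rabs (sq_coeff s n k * (- W) ^ k) <= v k).
    { intros k. destruct (sq_coeff_bound s n k H0s) as [B1 B2].
      rewrite Rabs_mult, <- RPow_abs, Rabs_Ropp, (Rabs_pos_eq W) by lra.
      rewrite Rabs_pos_eq by exact B1. apply Rmult_le_compat_r; [apply pow_le; lra|exact B2]. }
    pose proof (series_tail _ _ _ _ M E2 HV Hb') as Ht.
    apply Rabs_le_between in Ht. lra. }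
  rewrite (Rmult_comm (sum v K)), scal_sum, <- minus_sum.
  assert (HM : forall M, 0 <= V - sum v M).
  { intros M. pose proof (series_tail _ _ _ _ M HV HV) as Ht.
    eapply Rle_trans; [apply Rabs_pos | apply Ht].
    intros k. rewrite Rabs_pos_eq; [lra | apply v0]. }
  apply Rle_trans with (sum (fun n => (if Nat.eqb n n0 then D n0 * W ^ n0 * (J0 * J0) else 0)
      - (v n * V - sum (fun m => v n * v m) (K - n))) K).
  { rewrite (minus_sum (fun n => if Nat.eqb n n0 then _ else 0)).
    apply Rplus_le_compat_r.
    clear -HK H0s. induction K as [|K IH].
    - unfold n0 in HK. lia.
    - rewrite tech5. destruct (Nat.eq_dec n0 (S K)) as [E|E].
      + rewrite E, Nat.eqb_refl. rewrite sum_eq_R0; [lra|].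
        intros n Hn. replace (Nat.eqb n (S K)) with false; [reflexivity|].
        symmetry. apply Nat.eqb_neq. lia.
      + replace (Nat.eqb (S K) n0) with false by (symmetry; apply Nat.eqb_neq; lia).
        specialize (IH ltac:(lia)). lra. }
  apply sum_Rle. intros n Hn. destruct (HT n) as [E [E0 [E1 E2]]].
  specialize (E2 (K - n)%nat). specialize (HM (K - n)%nat).
  rewrite (sum_eq (fun m => v n * v m) (fun m => v m * v n)) by (intros; ring).
  rewrite <- scal_sum.
  rewrite (sum_eq (fun m => D n * W ^ n * _) (fun m => (sq_coeff s n m * (- W) ^ m) * (D n * W ^ n)))
    by (intros; ring).
  rewrite <- scal_sum.
  assert (D0 : 0 <= D n * W ^ n)
    by (apply Rmult_le_pos; [apply gasper_coeff_nonneg | apply pow_le; lra]).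
  assert (D1 : D n * W ^ n <= v n)
    by (apply Rmult_le_compat_r; [apply pow_le; lra | apply gasper_coeff_le]).
  assert (X1 : D n * W ^ n * (E - (V - sum v (K - n)))
     <= D n * W ^ n * sum (fun m => sq_coeff s n m * (- W) ^ m) (K - n))
    by now apply Rmult_le_compat_l.
  assert (X2 : D n * W ^ n * (V - sum v (K - n)) <= v n * (V - sum v (K - n)))
    by now apply Rmult_le_compat_r.
  destruct (Nat.eqb n n0) eqn:En.
  - apply Nat.eqb_eq in En. rewrite <- En in *. rewrite <- (E1 eq_refl). lra.
  - assert (0 <= D n * W ^ n * E) by now apply Rmult_le_pos. lra. }
pose proof (is_series_lim _ _ Hl) as Ll.
pose proof (is_series_lim _ _ HV) as LV.
pose proof (is_series_lim _ _ (is_series_mult _ _ _ _ HV HV Hv Hv)) as LM.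
(* Both parts of the cost tend to V^2, so the cost vanishes in the limit. *)
assert (LL : is_lim_seq (fun K => D n0 * W ^ n0 * (J0 * J0)
  - (sum v K * V - sum (fun k => sum (fun n => v n * v (k - n)%nat) k) K))
  (D n0 * W ^ n0 * (J0 * J0) - (V * V - V * V))).
{ apply is_lim_seq_minus'; [apply is_lim_seq_const|].
  apply is_lim_seq_minus'; [|exact LM].
  apply is_lim_seq_mult'; [exact LV | apply is_lim_seq_const]. }
rewrite Rminus_diag, Rminus_0_r in LL.
apply (is_lim_seq_le_loc _ _ (Finite _) (Finite _)) with (2 := LL) (3 := Ll).
exists n0. exact Hpart.
Qed.
End Gasper.

(** * Entire functions of order 1/2 *)

(** Convergence is stated through moduli, so that limits in C reduce to real limits. *)
Definition Ccv (f : nat -> C) (l : C) : Prop :=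
  is_lim_seq (fun n => Cmod (f n - l)%C) 0.

Lemma Cmod_triangle_minus (x y z : C) : Cmod (x - z) <= Cmod (x - y) + Cmod (y - z).
Proof. replace (x - z)%C with ((x - y) + (y - z))%C by ring. apply Cmod_triangle. Qed.

Lemma Cmod_minus_sym (x y : C) : Cmod (x - y) = Cmod (y - x).
Proof. replace (x - y)%C with (- (y - x))%C by ring. apply Cmod_opp. Qed.

Lemma Ccv_dom (f : nat -> C) (l : C) (e : nat -> R) :
  (forall n, Cmod (f n - l) <= e n) -> is_lim_seq e 0 -> Ccv f l.
Proof.
intros H He. apply is_lim_seq_le_le with (fun _ => 0) e; auto.
- intros n. split; [apply Cmod_ge_0 | apply H].
- apply is_lim_seq_const.
Qed.

Lemma Ccv_unique (f : nat -> C) (l l' : C) : Ccv f l -> Ccv f l' -> l = l'.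
Proof.
intros H H'. apply Ceq_minus, Cmod_eq_0.
apply Rle_antisym; [|apply Cmod_ge_0].
apply (is_lim_seq_le (fun _ => Cmod (l - l')) (fun n => Cmod (f n - l) + Cmod (f n - l'))
  (Finite _) (Finite 0)).
- intros n. rewrite (Cmod_minus_sym (f n) l). apply Cmod_triangle_minus.
- apply is_lim_seq_const.
- rewrite <- (Rplus_0_r 0). now apply is_lim_seq_plus'.
Qed.

Lemma Ccv_ext (f g : nat -> C) (l : C) : (forall n, f n = g n) -> Ccv f l -> Ccv g l.
Proof. intros E. apply is_lim_seq_ext. intros n. now rewrite E. Qed.

Lemma Ccv_plus (f g : nat -> C) (l m : C) :
  Ccv f l -> Ccv g m -> Ccv (fun n => f n + g n)%C (l + m)%C.
Proof.
intros H H'. apply Ccv_dom with (fun n => Cmod (f n - l) + Cmod (g n - m)).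
- intros n. replace (f n + g n - (l + m))%C with ((f n - l) + (g n - m))%C by ring.
  apply Cmod_triangle.
- rewrite <- (Rplus_0_r 0). now apply is_lim_seq_plus'.
Qed.

Lemma Ccv_scal (c : C) (f : nat -> C) (l : C) : Ccv f l -> Ccv (fun n => c * f n)%C (c * l)%C.
Proof.
intros H. apply Ccv_dom with (fun n => Cmod c * Cmod (f n - l)).
- intros n. replace (c * f n - c * l)%C with (c * (f n - l))%C by ring.
  rewrite Cmod_mult. lra.
- rewrite <- (Rmult_0_r (Cmod c)). apply is_lim_seq_mult'; [apply is_lim_seq_const | exact H].
Qed.

Lemma Ccv_const (c : C) : Ccv (fun _ => c) c.
Proof.
apply Ccv_dom with (fun _ => 0); [|apply is_lim_seq_const].
intros n. replace (c - c)%C with (RtoC 0) by ring. rewrite Cmod_0. lra.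
Qed.

Lemma Ccv_Cmod (f : nat -> C) (l c : C) : Ccv f l ->
  is_lim_seq (fun n => Cmod (f n - c)) (Cmod (l - c)).
Proof.
intros H.
apply is_lim_seq_le_le with (fun n => Cmod (l - c) - Cmod (f n - l))
  (fun n => Cmod (l - c) + Cmod (f n - l)).
- intros n. pose proof (Cmod_triangle_minus (f n) l c).
  pose proof (Cmod_triangle_minus l (f n) c). rewrite (Cmod_minus_sym l (f n)) in H1. lra.
- replace (Finite (Cmod (l - c))) with (Finite (Cmod (l - c) - 0)) by (f_equal; ring).
  apply is_lim_seq_minus'; [apply is_lim_seq_const | exact H].
- replace (Finite (Cmod (l - c))) with (Finite (Cmod (l - c) + 0)) by (f_equal; ring).
  apply is_lim_seq_plus'; [apply is_lim_seq_const | exact H].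
Qed.

Definition psum (h : nat -> C) (w : C) (n : nat) : C :=
  sum_n (fun k => (h k * w ^ k)%C) n.

Lemma psum_0 (h : nat -> C) (w : C) : psum h w 0 = h O.
Proof. unfold psum. rewrite sum_O. simpl. ring. Qed.

Lemma psum_S (h : nat -> C) (w : C) (n : nat) :
  psum h w (S n) = (psum h w n + h (S n) * w ^ S n)%C.
Proof. unfold psum. now rewrite sum_Sn. Qed.

Lemma psum_shift (h : nat -> C) (w : C) (n : nat) :
  psum h w (S n) = (h O + w * psum (fun k => h (S k)) w n)%C.
Proof.
induction n as [|n IH].
- rewrite psum_S, !psum_0. simpl. ring.
- rewrite psum_S, IH, (psum_S (fun k => h (S k))). simpl. ring.
Qed.

(* Coefficients of an entire function of order at most 1/2 and finite type. *)
Definition half_order_bound (M A : R) (h : nat -> C) : Prop :=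
  0 <= M /\ 0 <= A /\ forall k, Cmod (h k) <= M * (A ^ k / INR (fact (2 * k))).

Definition ev (h : nat -> C) (w : C) : C := CSeries (fun k => (h k * w ^ k)%C).

Lemma even_exp_bound (x : R) (n : nat) : 0 <= x ->
  sum (fun k => (x * x) ^ k / INR (fact (2 * k))) n <= exp x.
Proof.
intros Hx.
apply Rle_trans with (sum (fun k => / INR (fact k) * x ^ k) (2 * n)).
- induction n as [|n IH]; [simpl; lra|].
  replace (2 * S n)%nat with (S (S (2 * n))) at 1 by lia. rewrite tech5.
  replace (sum (fun k => / INR (fact k) * x ^ k) (2 * S n)) with
    (sum (fun k => / INR (fact k) * x ^ k) (S (S (2 * n)))) by (f_equal; lia).
  rewrite !tech5.
  assert (0 <= / INR (fact (S (2 * n))) * x ^ S (2 * n)).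
  { apply Rmult_le_pos; [apply Rlt_le, Rinv_0_lt_compat, INR_fact_lt_0 | now apply pow_le]. }
  replace ((x * x) ^ S n / INR (fact (2 * S n)))
    with (/ INR (fact (S (S (2 * n)))) * x ^ S (S (2 * n))).
  + lra.
  + replace (2 * S n)%nat with (S (S (2 * n))) by lia. unfold Rdiv. rewrite Rmult_comm. f_equal.
    replace (S (S (2 * n))) with (2 * S n)%nat by lia. rewrite pow_mult. f_equal. simpl. ring.
- pose proof (is_series_lim _ _ (is_series_exp x)) as H.
  apply (is_lim_seq_incr_compare _ _ H). intros m. rewrite tech5.
  assert (0 <= / INR (fact (S m)) * x ^ S m).
  { apply Rmult_le_pos; [apply Rlt_le, Rinv_0_lt_compat, INR_fact_lt_0 | now apply pow_le]. }
  lra.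
Qed.

Lemma fact_double_ge (k : nat) : INR (fact k) <= INR (fact (2 * k)).
Proof. apply le_INR, fact_le. lia. Qed.

Definition majorant (M A r : R) (k : nat) : R := M * ((A * r) ^ k / INR (fact (2 * k))).

Lemma majorant_summable (M A r : R) : 0 <= A -> 0 <= r -> ex_series (majorant M A r).
Proof.
intros HA Hr.
apply (ex_series_scal_l M (fun k => (A * r) ^ k / INR (fact (2 * k)))).
apply (@ex_series_le R_AbsRing R_CompleteNormedModule _
  (fun k => / INR (fact k) * (A * r) ^ k)); [|eexists; apply is_series_exp].
intros k. change (Rabs ((A * r) ^ k / INR (fact (2 * k))) <= / INR (fact k) * (A * r) ^ k).
assert (0 <= (A * r) ^ k) by (apply pow_le, Rmult_le_pos; auto).
rewrite Rabs_pos_eq.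
- unfold Rdiv. rewrite Rmult_comm. apply Rmult_le_compat_r; [auto|].
  apply Rinv_le_contravar; [apply INR_fact_lt_0 | apply fact_double_ge].
- apply Rmult_le_pos; [auto|]. apply Rlt_le, Rinv_0_lt_compat, INR_fact_lt_0.
Qed.

Lemma term_dom (M A r : R) (h : nat -> C) (w : C) (k : nat) :
  half_order_bound M A h -> Cmod w <= r -> Cmod (h k * w ^ k) <= majorant M A r k.
Proof.
intros [HM [HA Hh]] Hw. rewrite Cmod_mult, Cmod_pow. unfold majorant.
replace (M * ((A * r) ^ k / INR (fact (2 * k)))) with
  (M * (A ^ k / INR (fact (2 * k))) * r ^ k).
- apply Rmult_le_compat; [apply Cmod_ge_0 | apply pow_le, Cmod_ge_0 | apply Hh |].
  apply pow_incr. split; [apply Cmod_ge_0 | exact Hw].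
- rewrite Rpow_mult_distr. field. apply INR_fact_neq_0.
Qed.

Lemma is_series_Ccv (u : nat -> C) (l : C) :
  @is_series C_AbsRing C_NormedModule u l -> Ccv (sum_n u) l.
Proof.
intros H. apply is_lim_seq_spec. intros eps.
assert (Hs : 0 < eps / 2) by (destruct eps; simpl; lra).
destruct (H (ball l (eps / 2)) (locally_ball l (mkposreal _ Hs))) as [N HN].
exists N. intros n Hn. specialize (HN n Hn).
rewrite Rminus_0_r, Rabs_pos_eq by apply Cmod_ge_0.
pose proof (C_NormedModule_mixin_compat2 l (sum_n u n) (mkposreal _ Hs) HN) as H2.
simpl in H2. eapply Rlt_le_trans; [exact H2|].
assert (sqrt 2 <= 2) by (rewrite <- (sqrt_square 2) at 2 by lra; apply sqrt_le_1; lra).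
destruct eps as [e he]; simpl in *. nra.
Qed.

Lemma ev_Ccv (M A : R) (h : nat -> C) (w : C) : half_order_bound M A h ->
  Ccv (psum h w) (ev h w).
Proof.
intros H. apply is_series_Ccv.
apply CSeries_correct with (majorant M A (Cmod w)).
- intros k. apply term_dom; [exact H | lra].
- apply majorant_summable; [apply H | apply Cmod_ge_0].
Qed.

Lemma psum_tail (M A r : R) (h : nat -> C) (w : C) (n : nat) :
  half_order_bound M A h -> Cmod w <= r ->
  Cmod (ev h w - psum h w n) <= Series (majorant M A r) - sum (majorant M A r) n.
Proof.
intros H Hw.
assert (Hr : 0 <= r) by (eapply Rle_trans; [apply Cmod_ge_0 | exact Hw]).
assert (HN : forall m, Cmod (psum h w (m + n) - psum h w n)
   <= sum (majorant M A r) (m + n) - sum (majorant M A r) n).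
{ induction m as [|m IH].
  - simpl. replace (psum h w n - psum h w n)%C with (RtoC 0) by ring. rewrite Cmod_0. lra.
  - simpl (S m + n)%nat. rewrite psum_S, tech5.
    replace (psum h w (m + n) + h (S (m + n)) * w ^ S (m + n) - psum h w n)%C
      with ((psum h w (m + n) - psum h w n) + h (S (m + n)) * w ^ S (m + n))%C by ring.
    pose proof (Cmod_triangle (psum h w (m + n) - psum h w n) (h (S (m + n)) * w ^ S (m + n))).
    pose proof (term_dom M A r h w (S (m + n)) H Hw). lra. }
pose proof (Ccv_Cmod _ _ (psum h w n) (ev_Ccv M A h w H)) as L1.
apply (is_lim_seq_incr_n _ n) in L1.
pose proof (is_series_lim _ _ (Series_correct _ (majorant_summable M A r (proj1 (proj2 H)) Hr))) as L2.
apply (is_lim_seq_incr_n _ n) in L2.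
refine (is_lim_seq_le _ _ (Finite _) (Finite _) HN L1 _).
apply is_lim_seq_minus'; [exact L2 | apply is_lim_seq_const].
Qed.

Lemma majorant_tail_lim (M A r : R) : 0 <= A -> 0 <= r ->
  is_lim_seq (fun n => Series (majorant M A r) - sum (majorant M A r) n) 0.
Proof.
intros HA Hr. rewrite <- (Rminus_diag (Series (majorant M A r))).
apply is_lim_seq_minus'; [apply is_lim_seq_const|].
apply is_series_lim, Series_correct, majorant_summable; auto.
Qed.

Lemma psum_growth (M A : R) (h : nat -> C) (w : C) (n : nat) : half_order_bound M A h ->
  Cmod (psum h w n) <= M * exp (sqrt (A * Cmod w)).
Proof.
intros H. pose proof H as [HM [HA _]].
assert (HAw : 0 <= A * Cmod w) by (apply Rmult_le_pos; [auto | apply Cmod_ge_0]).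
apply Rle_trans with (sum (majorant M A (Cmod w)) n).
- induction n as [|n IH].
  + rewrite psum_0. pose proof (term_dom M A (Cmod w) h w 0 H (Rle_refl _)) as T.
    simpl in T. rewrite Cmult_1_r in T. exact T.
  + rewrite psum_S, tech5.
    eapply Rle_trans; [apply Cmod_triangle|]. apply Rplus_le_compat; [exact IH|].
    apply term_dom; [exact H | lra].
- unfold majorant. rewrite (sum_eq _ (fun k => ((A * Cmod w) ^ k / INR (fact (2 * k))) * M))
    by (intros; ring).
  rewrite <- scal_sum. apply Rmult_le_compat_l; [auto|].
  pose proof (even_exp_bound (sqrt (A * Cmod w)) n (sqrt_pos _)) as B.
  rewrite sqrt_sqrt in B by auto. exact B.
Qed.

Lemma ev_growth (M A : R) (h : nat -> C) (w : C) : half_order_bound M A h ->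
  Cmod (ev h w) <= M * exp (sqrt (A * Cmod w)).
Proof.
intros H. pose proof (Ccv_Cmod _ _ (RtoC 0) (ev_Ccv M A h w H)) as L.
replace (ev h w - 0)%C with (ev h w) in L by ring.
refine (is_lim_seq_le _ (fun _ => M * exp (sqrt (A * Cmod w))) (Finite _) (Finite _) _ L
  (is_lim_seq_const _)).
intros n. replace (psum h w n - 0)%C with (psum h w n) by ring. now apply psum_growth.
Qed.

Lemma ev_shift (M A : R) (M' A' : R) (h : nat -> C) (w : C) :
  half_order_bound M A h -> half_order_bound M' A' (fun k => h (S k)) ->
  ev h w = (h O + w * ev (fun k => h (S k)) w)%C.
Proof.
intros H H'. apply Ccv_unique with (fun n => psum h w (S n)).
- apply (is_lim_seq_incr_1 (fun n => Cmod (psum h w n - ev h w))). now apply (ev_Ccv M A).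
- apply Ccv_ext with (fun n => h O + w * psum (fun k => h (S k)) w n)%C.
  + intros n. now rewrite psum_shift.
  + apply Ccv_plus; [apply Ccv_const|]. apply Ccv_scal. now apply (ev_Ccv M' A').
Qed.

(** * Difference quotients *)

Lemma fact_mult_le (m n : nat) : (fact m * fact n <= fact (m + n))%nat.
Proof.
induction n as [|n IH]; [rewrite Nat.add_0_r; simpl; lia|].
rewrite Nat.add_succ_r. simpl fact at 2 3. nia.
Qed.

(** From (2k)! (2i)! <= (2 (k + 1 + i))!. The constant keeps the factor A^k / (2k)!, so the values
    of the shifted series are again coefficients of half order with the same A. *)
Lemma half_order_shift (M A : R) (h : nat -> C) (k : nat) : half_order_bound M A h ->
  half_order_bound (M * A * (A ^ k / INR (fact (2 * k)))) A (fun i => h (k + 1 + i)%nat).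
Proof.
intros [HM [HA Hh]]. pose proof (INR_fact_lt_0 (2 * k)) as P1.
assert (P0 : 0 <= A ^ k / INR (fact (2 * k))).
{ apply Rmult_le_pos; [now apply pow_le|]. now apply Rlt_le, Rinv_0_lt_compat. }
split; [apply Rmult_le_pos; [now apply Rmult_le_pos|exact P0]|]. split; [exact HA|]. intros i.
eapply Rle_trans; [apply Hh|].
replace (M * A * (A ^ k / INR (fact (2 * k))) * (A ^ i / INR (fact (2 * i))))
  with (M * (A ^ (k + 1 + i) * / (INR (fact (2 * k)) * INR (fact (2 * i))))).
- apply Rmult_le_compat_l; [auto|]. apply Rmult_le_compat_l; [now apply pow_le|].
  apply Rinv_le_contravar; [apply Rmult_lt_0_compat; apply INR_fact_lt_0|].
  rewrite <- mult_INR. apply le_INR. eapply Nat.le_trans; [apply fact_mult_le|].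
  apply fact_le. lia.
- rewrite !pow_add, pow_1. field. split; apply INR_fact_neq_0.
Qed.

(* Coefficients of [w |-> (ev h w - ev h z) / (w - z)]. *)
Definition quot (h : nat -> C) (z : C) (k : nat) : C := ev (fun i => h (k + 1 + i)%nat) z.

Lemma quot_bound (M A : R) (h : nat -> C) (z : C) : half_order_bound M A h ->
  half_order_bound (M * A * exp (sqrt (A * Cmod z))) A (quot h z).
Proof.
intros H. pose proof H as [HM [HA Hh]].
split; [apply Rmult_le_pos; [now apply Rmult_le_pos | apply Rlt_le, exp_pos]|].
split; [exact HA|]. intros k.
eapply Rle_trans; [apply ev_growth, half_order_shift, H|]. right. ring.
Qed.

Lemma ev_ext (h g : nat -> C) (w : C) : (forall k, h k = g k) -> ev h w = ev g w.
Proof.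
intros E. unfold ev, CSeries. f_equal; apply Series_ext; intros k; now rewrite E.
Qed.

Lemma quot_S (M A : R) (h : nat -> C) (z : C) (k : nat) : half_order_bound M A h ->
  quot h z k = (h (S k) + z * quot h z (S k))%C.
Proof.
intros H. unfold quot.
assert (E : forall i, h (S k + 1 + i)%nat = h (k + 1 + S i)%nat) by (intros; f_equal; lia).
rewrite (ev_ext _ _ z E).
assert (H' : half_order_bound (M * A * (A ^ S k / INR (fact (2 * S k)))) A
  (fun i => h (k + 1 + S i)%nat)).
{ destruct (half_order_shift M A h (S k) H) as [H1 [H2 H3]].
  split; [exact H1|]. split; [exact H2|]. intros i. rewrite <- E. apply H3. }
rewrite (ev_shift _ _ _ _ _ z (half_order_shift M A h k H) H').
f_equal. f_equal. lia.
Qed.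

(** Synthetic division of the partial sums leaves only the boundary term - z q_(n+1) w^(n+1), which
    tends to 0 because the quotient series converges. *)
Lemma quot_eq (M A : R) (h : nat -> C) (z w : C) : half_order_bound M A h ->
  ev h w = (ev h z + (w - z) * ev (quot h z) w)%C.
Proof.
intros H. pose proof (quot_bound M A h z H) as HQ.
assert (E0 : ev h z = (h O + z * quot h z 0)%C).
{ unfold quot. apply (ev_shift M A _ _ h z H (half_order_shift M A h 0 H)). }
assert (EN : forall n, psum h w (S n) =
  (ev h z + ((w - z) * psum (quot h z) w n + - z * (psum (quot h z) w (S n) - psum (quot h z) w n)))%C).
{ induction n as [|n IH].
  - rewrite !psum_S, !psum_0, E0, (quot_S M A h z 0 H). simpl. ring.
  - rewrite psum_S, IH, !(psum_S (quot h z)). rewrite (quot_S M A h z (S n) H).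
    simpl. ring. }
apply Ccv_unique with (fun n => psum h w (S n)).
- apply (is_lim_seq_incr_1 (fun n => Cmod (psum h w n - ev h w))). now apply (ev_Ccv M A).
- apply Ccv_ext with (1 := fun n => eq_sym (EN n)).
  apply Ccv_plus; [apply Ccv_const|].
  replace ((w - z) * ev (quot h z) w)%C
    with ((w - z) * ev (quot h z) w + - z * (ev (quot h z) w + - (1) * ev (quot h z) w))%C by ring.
  pose proof (ev_Ccv _ _ _ w HQ) as L.
  apply Ccv_plus; [now apply Ccv_scal|]. apply Ccv_scal.
  apply Ccv_ext with (fun n => psum (quot h z) w (S n) + - (1) * psum (quot h z) w n)%C;
    [intros; ring|].
  apply Ccv_plus; [|now apply Ccv_scal].
  now apply (is_lim_seq_incr_1 (fun n => Cmod (psum (quot h z) w n - ev (quot h z) w))).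
Qed.

(* [ring] needs the equality to be stated at [C], not at one of its structures. *)
Ltac Cring := match goal with |- @eq _ ?x ?y => change (@eq C x y); ring end.

(** * A discrete maximum principle *)

Definition cis (t : R) : C := (cos t, sin t).

Lemma cis_plus (x y : R) : cis (x + y) = (cis x * cis y)%C.
Proof. unfold cis, Cmult. simpl. rewrite cos_plus, sin_plus. f_equal; ring. Qed.

Lemma cis_pow (x : R) (k : nat) : (cis x ^ k)%C = cis (INR k * x).
Proof.
induction k as [|k IH].
- simpl. unfold cis. rewrite Rmult_0_l, cos_0, sin_0. reflexivity.
- rewrite S_INR, Rmult_plus_distr_r, Rmult_1_l, Rplus_comm, cis_plus, <- IH. reflexivity.
Qed.

Lemma cis_Cmod (x : R) : Cmod (cis x) = 1.
Proof.
unfold Cmod, cis. simpl. transitivity (sqrt 1); [f_equal | apply sqrt_1].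
pose proof (sin2_cos2 x). unfold Rsqr in H. lra.
Qed.

Lemma cis_neq_1 (t : R) : 0 < t < 2 * PI -> cis t <> RtoC 1.
Proof.
intros Ht E. apply (f_equal fst) in E. simpl in E.
replace t with (2 * (t / 2)) in E by field. rewrite cos_2a_sin in E.
pose proof (sin_gt_0 (t / 2) ltac:(lra) ltac:(lra)). nra.
Qed.

Lemma geometric (x : C) (n : nat) :
  ((x - 1) * sum_n (fun j => x ^ j)%C n)%C = (x ^ S n - 1)%C.
Proof.
induction n as [|n IH].
- rewrite sum_O. simpl. ring.
- rewrite sum_Sn. change plus with Cplus. rewrite Cmult_plus_distr_l, IH. simpl. ring.
Qed.

Lemma roots_of_unity_sum (n k : nat) : (0 < k <= n)%nat ->
  sum_n (fun j => (cis (2 * PI / INR (S n)) ^ k) ^ j)%C n = RtoC 0.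
Proof.
intros Hk. set (x := (cis (2 * PI / INR (S n)) ^ k)%C).
pose proof (lt_0_INR (S n) ltac:(lia)) as PN. pose proof PI_RGT_0 as HPI.
assert (E : (x ^ S n)%C = RtoC 1).
{ unfold x. rewrite !cis_pow.
  replace (INR (S n) * (INR k * (2 * PI / INR (S n)))) with (0 + 2 * INR k * PI) by (field; lra).
  unfold cis. rewrite cos_period, sin_period, cos_0, sin_0. reflexivity. }
assert (Hx : x <> RtoC 1).
{ unfold x. rewrite cis_pow. apply cis_neq_1.
  pose proof (lt_0_INR k ltac:(lia)). pose proof (lt_INR k (S n) ltac:(lia)).
  split.
  - apply Rmult_lt_0_compat; [auto|]. apply Rdiv_lt_0_compat; lra.
  - replace (INR k * (2 * PI / INR (S n))) with (INR k / INR (S n) * (2 * PI)) by (field; lra).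
    rewrite <- (Rmult_1_l (2 * PI)) at 2. apply Rmult_lt_compat_r; [lra|].
    apply Rlt_div_l; lra. }
pose proof (geometric x n) as G. rewrite E in G.
replace (1 - 1)%C with (RtoC 0) in G by ring.
destruct (Ceq_dec (sum_n (fun j => x ^ j)%C n) (RtoC 0)) as [H|H]; [exact H|].
exfalso. apply (Cmult_neq_0 (x - 1)%C _) in H; [now apply H|].
now apply Cminus_eq_contra.
Qed.

Lemma Cmod_sum_n_le (u : nat -> C) (B : R) (n : nat) :
  (forall k, (k <= n)%nat -> Cmod (u k) <= B) -> Cmod (sum_n u n) <= (INR n + 1) * B.
Proof.
induction n as [|n IH]; intros H.
- rewrite sum_O. simpl. rewrite Rplus_0_l, Rmult_1_l. apply H. lia.
- rewrite sum_Sn, S_INR. change plus with Cplus.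
  eapply Rle_trans; [apply Cmod_triangle|].
  specialize (IH (fun k Hk => H k (le_S _ _ Hk))). specialize (H (S n) (Nat.le_refl _)). lra.
Qed.

(** A discrete Cauchy formula: over n + 1 equally spaced points of a circle every power from 1 to n
    averages to 0, so a polynomial of degree at most n has its value at 0 as exact mean. *)
Lemma circle_mean (h : nat -> C) (r : R) (n M : nat) : (M <= n)%nat ->
  sum_n (fun j => psum h (r * cis (2 * PI / INR (S n)) ^ j)%C M) n
  = (RtoC (INR n + 1) * h O)%C.
Proof.
set (om := cis (2 * PI / INR (S n))).
induction M as [|M IH]; intros HM.
- rewrite (sum_n_ext _ (fun _ => h O)) by (intros; apply psum_0).
  clear. induction n as [|n IH].
  + rewrite sum_O. simpl. rewrite Rplus_0_l. ring.
  + rewrite sum_Sn, IH, S_INR, !RtoC_plus. change plus with Cplus. Cring.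
- rewrite (sum_n_ext _ (fun j => plus (psum h (r * om ^ j)%C M)
     (h (S M) * r ^ S M * (om ^ S M) ^ j)%C)).
  + rewrite sum_n_plus, IH by lia.
    rewrite (sum_n_ext _ (fun j => mult (h (S M) * r ^ S M)%C ((om ^ S M) ^ j)%C)) by reflexivity.
    rewrite sum_n_mult_l.
    pose proof (roots_of_unity_sum n (S M) ltac:(lia)) as Z. fold om in Z.
    match goal with |- plus ?x (mult ?y ?z) = ?t =>
      change (Cplus x (Cmult y z) = t); replace z with (RtoC 0) end.
    Cring.
  + intros j. rewrite psum_S. change plus with Cplus.
    rewrite Cpow_mult_l, <- !Cpow_mult_r, (Nat.mul_comm j). Cring.
Qed.

Lemma poly_max (h : nat -> C) (r B : R) (n : nat) : 0 <= r ->
  (forall w, Cmod w = r -> Cmod (psum h w n) <= B) -> Cmod (h O) <= B.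
Proof.
intros Hr HB. pose proof (circle_mean h r n n (Nat.le_refl n)) as E.
pose proof (pos_INR n).
apply Rmult_le_reg_l with (INR n + 1); [lra|].
rewrite <- (Rabs_pos_eq (INR n + 1)) at 1 by lra. rewrite <- Cmod_R, <- Cmod_mult, <- E.
apply Cmod_sum_n_le. intros k _. apply HB.
rewrite Cmod_mult, Cmod_pow, cis_Cmod, pow1, Cmod_R, Rabs_pos_eq; lra.
Qed.

Lemma ev_max (M A : R) (h : nat -> C) (r B : R) : half_order_bound M A h -> 0 <= r ->
  (forall w, Cmod w = r -> Cmod (ev h w) <= B) -> Cmod (h O) <= B.
Proof.
intros H Hr HB. pose proof H as [_ [HA _]].
assert (L := is_lim_seq_plus' _ _ _ _ (is_lim_seq_const B) (majorant_tail_lim M A r HA Hr)).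
rewrite Rplus_0_r in L.
refine (is_lim_seq_le (fun _ => Cmod (h O)) _ (Finite _) (Finite _) _ (is_lim_seq_const _) L).
intros n. cbv beta. apply poly_max with r n; [exact Hr|]. intros w Hw.
pose proof (psum_tail M A r h w n H (Req_le _ _ Hw)) as T. specialize (HB w Hw).
rewrite Cmod_minus_sym in T.
replace (psum h w n) with (ev h w + (psum h w n - ev h w))%C by ring.
pose proof (Cmod_triangle (ev h w) (psum h w n - ev h w)). lra.
Qed.

(** * Counting zeros and summing their reciprocals *)

Lemma lin_prod_coeffs (l : list C) : exists h n, h O = RtoC 1 /\
  (forall k, (n < k)%nat -> h k = RtoC 0) /\ forall w, psum h w n = lin_prod l w.
Proof.
induction l as [|u l [h [n [H0 [Hz Hp]]]]].
- exists (fun k => match k with O => RtoC 1 | _ => RtoC 0 end), 0%nat.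
  split; [reflexivity|]. split; [intros [|k] Hk; [lia|reflexivity]|].
  intros w. rewrite psum_0. reflexivity.
- exists (fun k => match k with O => h O | S j => (h (S j) - u * h j)%C end), (S n).
  split; [exact H0|]. split.
  + intros [|k] Hk; [lia|]. rewrite !Hz by lia. ring.
  + intros w. simpl. rewrite <- Hp.
    assert (E : forall m, psum (fun k => match k with O => h O | S j => (h (S j) - u * h j)%C end) w (S m)
       = (psum h w (S m) - w * u * psum h w m)%C).
    { induction m as [|m IH].
      - rewrite !psum_S, !psum_0. simpl. ring.
      - rewrite psum_S, IH, !(psum_S h). simpl. ring. }
    rewrite E, psum_S, Hz by lia. ring.
Qed.

Lemma lin_prod_max (l : list C) (r B : R) : 0 <= r ->
  (forall w, Cmod w = r -> Cmod (lin_prod l w) <= B) -> 1 <= B.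
Proof.
intros Hr HB. destruct (lin_prod_coeffs l) as [h [n [H0 [_ Hp]]]].
rewrite <- Cmod_1, <- H0. apply poly_max with r n; [exact Hr|].
intros w Hw. rewrite Hp. now apply HB.
Qed.

(** The radius 3 r gives |w u| >= 3, hence a factor of modulus at least 3 - 1 = 2. *)
Lemma factor_lower (u w : C) (r : R) : 0 < r -> 1 <= r * Cmod u -> Cmod w = 3 * r ->
  2 <= Cmod (1 - w * u).
Proof.
intros Hr Hu Hw. pose proof (Cmod_triangle (1 - w * u) (-(1))) as T.
replace (1 - w * u + - (1))%C with (- (w * u))%C in T by ring.
rewrite !Cmod_opp, Cmod_mult, Cmod_1, Hw in T. nra.
Qed.

(** As the entries are reciprocals of zeros, this is the number of zeros of modulus at most r. *)
Definition count_ge (r : R) (l : list C) : nat :=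
  length (filter (fun u => if Rle_dec 1 (r * Cmod u) then true else false) l).

(* Dividing out the factors counted here, each at least 2 in modulus on the circle of
   radius [3 r], a weak form of Jensen's inequality follows from the maximum principle. *)
Lemma count_bound (l : list C) (r B : R) : 0 < r ->
  (forall w, Cmod w = 3 * r -> Cmod (lin_prod l w) <= B) -> 2 ^ count_ge r l <= B.
Proof.
intros Hr HB. set (t := fun u => if Rle_dec 1 (r * Cmod u) then true else false).
assert (HN : forall w, Cmod w = 3 * r ->
  2 ^ count_ge r l * Cmod (lin_prod (filter (fun u => negb (t u)) l) w) <= Cmod (lin_prod l w)).
{ intros w Hw. clear HB. unfold count_ge. fold t. induction l as [|u l IH].
  - simpl. rewrite Cmod_1. lra.
  - simpl. destruct (t u) eqn:Et; simpl; rewrite !Cmod_mult.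
    + assert (Hu : 1 <= r * Cmod u)
        by (unfold t in Et; destruct (Rle_dec 1 (r * Cmod u)); [assumption | discriminate]).
      rewrite Rmult_assoc. apply Rmult_le_compat; [lra| |now apply factor_lower with r|exact IH].
      apply Rmult_le_pos; [apply pow_le; lra | apply Cmod_ge_0].
    + rewrite (Rmult_comm (Cmod (1 - w * u))), <- Rmult_assoc, (Rmult_comm (Cmod (1 - w * u))).
      apply Rmult_le_compat_r; [apply Cmod_ge_0 | exact IH]. }
assert (P2 : 0 < 2 ^ count_ge r l) by (apply pow_lt; lra).
apply Rmult_le_reg_r with (/ 2 ^ count_ge r l); [now apply Rinv_0_lt_compat|].
rewrite Rinv_r by lra.
apply lin_prod_max with (filter (fun u => negb (t u)) l) (3 * r); [lra|].
intros w Hw. specialize (HN w Hw). specialize (HB w Hw).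
apply Rmult_le_reg_l with (2 ^ count_ge r l); [exact P2|].
replace (2 ^ count_ge r l * (B * / 2 ^ count_ge r l)) with B by (field; lra). lra.
Qed.

Definition abs_sum (l : list C) : R := fold_right (fun u acc => Cmod u + acc) 0 l.

Lemma abs_sum_nonneg (l : list C) : 0 <= abs_sum l.
Proof. induction l as [|u l IH]; simpl; [lra|]. pose proof (Cmod_ge_0 u). lra. Qed.

Lemma lin_prod_near_1 (l : list C) (w : C) :
  Cmod (lin_prod l w - 1) <= exp (Cmod w * abs_sum l) - 1.
Proof.
induction l as [|u l IH]; simpl.
- replace (1 - 1)%C with (RtoC 0) by ring. rewrite Cmod_0, Rmult_0_r, exp_0. lra.
- replace ((1 - w * u) * lin_prod l w - 1)%C
    with ((1 - w * u) * (lin_prod l w - 1) + - (w * u))%C by ring.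
  pose proof (Cmod_triangle ((1 - w * u) * (lin_prod l w - 1)) (- (w * u))) as T.
  rewrite Cmod_mult, Cmod_opp, Cmod_mult in T.
  pose proof (Cmod_triangle 1 (- (w * u))) as T2. rewrite Cmod_opp, Cmod_mult, Cmod_1 in T2.
  replace (1 + - (w * u))%C with (1 - w * u)%C in T2 by ring.
  rewrite Rmult_plus_distr_l, exp_plus.
  set (x := Cmod w * Cmod u) in *. set (E := exp (Cmod w * abs_sum l)) in *.
  assert (Hx : 0 <= x) by (apply Rmult_le_pos; apply Cmod_ge_0).
  assert (HE : 1 <= E).
  { unfold E. rewrite <- exp_0. destruct (Rle_lt_or_eq_dec 0 (Cmod w * abs_sum l)) as [H|H].
    - apply Rmult_le_pos; [apply Cmod_ge_0 | apply abs_sum_nonneg].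
    - left. now apply exp_increasing.
    - rewrite <- H. lra. }
  pose proof (exp_ineq1_le x) as Hex.
  apply Rle_trans with ((1 + x) * (E - 1) + x).
  + eapply Rle_trans; [exact T|]. apply Rplus_le_compat_r.
    apply Rmult_le_compat; auto; apply Cmod_ge_0.
  + assert ((1 + x) * E <= exp x * E) by (apply Rmult_le_compat_r; lra). lra.
Qed.

(** The first layer i whose indicator is 1 has 4^i R0 |u| < 1, so its weight alone bounds |u|. If
    there is no such layer up to I, the remainder does. *)
Lemma abs_le_layers (u : C) (R0 : R) (I : nat) : 0 < R0 -> R0 * Cmod u < 1 ->
  Cmod u <= sum (fun i => (/ 4) ^ i / R0 *
     (if Rle_dec 1 (4 ^ S i * R0 * Cmod u) then 1 else 0)) I + (/ 4) ^ S I / R0.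
Proof.
intros HR Hu.
assert (Hpos : forall i, 0 < (/ 4) ^ i / R0)
  by (intros; apply Rdiv_lt_0_compat; [apply pow_lt; lra | lra]).
assert (Hcase : forall i, 4 ^ i * R0 * Cmod u < 1 -> Cmod u <= (/ 4) ^ i / R0).
{ intros i Hi. rewrite pow_inv. pose proof (pow_lt 4 i ltac:(lra)).
  apply Rmult_le_reg_l with (4 ^ i * R0); [now apply Rmult_lt_0_compat|].
  replace (4 ^ i * R0 * (/ 4 ^ i / R0)) with 1 by (field; lra). lra. }
assert (Hs : forall n, 0 <= sum (fun i => (/ 4) ^ i / R0 *
     (if Rle_dec 1 (4 ^ S i * R0 * Cmod u) then 1 else 0)) n).
{ intros n. apply cond_pos_sum. intros i. pose proof (Hpos i). destruct Rle_dec; lra. }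
induction I as [|I IH].
- cbn [sum_f_R0]. destruct Rle_dec as [H|H].
  + specialize (Hcase 0%nat). simpl pow at 1. simpl in Hcase.
    pose proof (Hpos 1%nat). specialize (Hcase ltac:(lra)). simpl. simpl in H0. lra.
  + apply Rnot_le_lt in H. specialize (Hcase 1%nat H). lra.
- rewrite tech5. destruct Rle_dec as [H|H].
  + pose proof (Hpos (S (S I))). lra.
  + apply Rnot_le_lt in H. specialize (Hcase (S (S I)) H). specialize (Hs I). lra.
Qed.

Lemma abs_sum_layers (l : list C) (R0 : R) (I : nat) : 0 < R0 ->
  (forall u, In u l -> R0 * Cmod u < 1) ->
  abs_sum l <= sum (fun i => (/ 4) ^ i / R0 * INR (count_ge (4 ^ S i * R0) l)) I
     + INR (length l) * ((/ 4) ^ S I / R0).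
Proof.
intros HR. induction l as [|u l IH]; intros Hl.
- simpl abs_sum. simpl length. rewrite Rmult_0_l, Rplus_0_r. apply cond_pos_sum. intros i.
  unfold count_ge. simpl. lra.
- specialize (IH (fun v Hv => Hl v (or_intror Hv))).
  pose proof (abs_le_layers u R0 I HR (Hl u (or_introl eq_refl))) as Hu.
  simpl abs_sum. simpl length. rewrite S_INR, Rmult_plus_distr_r, Rmult_1_l.
  rewrite (sum_eq _ (fun i => (/ 4) ^ i / R0 * INR (count_ge (4 ^ S i * R0) l) +
     (/ 4) ^ i / R0 * (if Rle_dec 1 (4 ^ S i * R0 * Cmod u) then 1 else 0))).
  + rewrite sum_plus. lra.
  + intros i Hi. unfold count_ge. cbn [filter].
    destruct (Rle_dec 1 (4 ^ S i * R0 * Cmod u)); cbn [length]; rewrite ?S_INR; ring.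
Qed.

Lemma half_order_M_ge_1 (M A : R) (h : nat -> C) : half_order_bound M A h ->
  h O = RtoC 1 -> 1 <= M.
Proof.
intros [_ [_ H]] H0. specialize (H O). rewrite H0, Cmod_1 in H. simpl in H. lra.
Qed.

(** Here order 1/2 is decisive: a disc of radius r >= 1 holds O(sqrt r) zeros. Along the radii 4^i
    rho^2 the counts grow like 2^i rho against weights 4^(-i) / rho^2, which sums to O(1 / rho). The
    constant does not involve the degree n. *)
Lemma abs_sum_small (M A rho : R) (h : nat -> C) (n : nat) (l : list C) :
  half_order_bound M A h -> h O = RtoC 1 -> 1 <= rho ->
  (forall w, psum h w n = lin_prod l w) ->
  (forall u, In u l -> rho * rho * Cmod u < 1) ->
  abs_sum l <= 4 * ((ln M + sqrt (3 * A)) / ln 2) / rho.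
Proof.
intros H H0 Hrho Hp Hl. pose proof (half_order_M_ge_1 M A h H H0) as HM.
pose proof H as [_ [HA _]].
set (K := (ln M + sqrt (3 * A)) / ln 2).
assert (L2 : 0 < ln 2) by (rewrite <- ln_1; apply ln_increasing; lra).
assert (LM : 0 <= ln M).
{ rewrite <- ln_1. destruct (Req_dec M 1) as [->|HM1]; [lra|].
  left. apply ln_increasing; lra. }
pose proof (sqrt_pos (3 * A)) as SA.
assert (HK : 0 <= K) by (apply Rmult_le_pos; [lra | now apply Rlt_le, Rinv_0_lt_compat]).
assert (HR : 0 < rho * rho) by nra.
assert (Hc : forall i, INR (count_ge (4 ^ S i * (rho * rho)) l) <= K * (2 ^ S i * rho)).
{ intros i. set (x := 2 ^ S i * rho).
  (* This lets the constant ln M be absorbed into a multiple of x. *)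
  assert (Hx : 1 <= x).
  { unfold x. pose proof (pow_R1_Rle 2 (S i) ltac:(lra)). nra. }
  replace (4 ^ S i * (rho * rho)) with (x * x).
  2:{ unfold x. replace 4 with (2 * 2) by ring. rewrite Rpow_mult_distr. ring. }
  assert (B : 2 ^ count_ge (x * x) l <= M * exp (sqrt (3 * A) * x)).
  { apply count_bound; [nra|]. intros w Hw. rewrite <- Hp.
    pose proof (psum_growth M A h w n H) as G. rewrite Hw in G.
    replace (A * (3 * (x * x))) with (3 * A * (x * x)) in G by ring.
    rewrite sqrt_mult, sqrt_square in G by nra. exact G. }
  unfold K. apply Rmult_le_reg_r with (ln 2); [exact L2|].
  replace ((ln M + sqrt (3 * A)) / ln 2 * x * ln 2) with ((ln M + sqrt (3 * A)) * x)
    by (field; lra).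
  rewrite <- ln_pow by lra.
  apply Rle_trans with (ln (M * exp (sqrt (3 * A) * x))).
  - apply ln_le; [apply pow_lt; lra | exact B].
  - rewrite ln_mult, ln_exp by (try apply exp_pos; lra). nra. }
assert (HI : forall I, abs_sum l <= 4 * K / rho + INR (length l) * ((/ 4) ^ S I / (rho * rho))).
{ intros I. eapply Rle_trans; [apply (abs_sum_layers l _ I HR Hl)|].
  apply Rplus_le_compat_r.
  apply Rle_trans with (sum (fun i => (/ 2) ^ i * (2 * K / rho)) I).
  - apply sum_Rle. intros i _.
    apply Rle_trans with ((/ 4) ^ i / (rho * rho) * (K * (2 ^ S i * rho))).
    + apply Rmult_le_compat_l; [|apply Hc].
      apply Rlt_le, Rdiv_lt_0_compat; [apply pow_lt|]; lra.
    + right. replace (/ 4) with (/ 2 * / 2) by field. rewrite Rpow_mult_distr.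
      simpl (2 ^ S i). rewrite pow_inv. field. split; [lra|].
      apply Rgt_not_eq, pow_lt; lra.
  - rewrite <- scal_sum, tech3 by lra.
    replace (4 * K / rho) with (2 * K / rho * ((1 - 0) / (1 - / 2))) by (field; lra).
    apply Rmult_le_compat_l.
    + apply Rmult_le_pos; [lra | apply Rlt_le, Rinv_0_lt_compat; lra].
    + apply Rmult_le_compat_r; [lra|]. pose proof (pow_lt (/ 2) (S I) ltac:(lra)). lra. }
assert (L : is_lim_seq (fun I => 4 * K / rho + INR (length l) * ((/ 4) ^ S I / (rho * rho)))
  (4 * K / rho + INR (length l) * (0 / (rho * rho)))).
{ apply is_lim_seq_plus'; [apply is_lim_seq_const|].
  apply is_lim_seq_mult'; [apply is_lim_seq_const|].
  apply is_lim_seq_mult'; [|apply is_lim_seq_const].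
  apply -> (is_lim_seq_incr_1 (fun I => (/ 4) ^ I)). apply is_lim_seq_geom.
  rewrite Rabs_pos_eq; lra. }
replace (4 * K / rho + INR (length l) * (0 / (rho * rho))) with (4 * K / rho) in L by (field; lra).
exact (is_lim_seq_le _ _ (Finite _) (Finite _) HI (is_lim_seq_const _) L).
Qed.

(** * Functions with no zeros, and with finitely many *)

Lemma ev_lower_near (M A : R) (h : nat -> C) (z : C) : half_order_bound M A h ->
  ev h z <> RtoC 0 ->
  exists d : posreal, forall w, Cmod (w - z) < 2 * d -> d <= Cmod (ev h w).
Proof.
intros H Hz. apply Cmod_gt_0 in Hz. set (m := Cmod (ev h z)) in *.
pose proof (quot_bound M A h z H) as HQ. set (M' := M * A * exp (sqrt (A * Cmod z))) in HQ.
set (L := M' * exp (sqrt (A * (Cmod z + 1)))).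
assert (HL : 0 <= L) by (apply Rmult_le_pos; [apply HQ | apply Rlt_le, exp_pos]).
set (d := Rmin (1 / 2) (m / (2 * (L + 1)))).
assert (Hm : 0 < m / (2 * (L + 1))) by (apply Rdiv_lt_0_compat; lra).
assert (Hd : 0 < Rmin (d) (m / 2)).
{ apply Rmin_pos; [apply Rmin_pos; lra | lra]. }
set (e := Rmin d (m / 2) / 2). assert (He : 0 < e) by (unfold e; lra).
exists (mkposreal e He). simpl. intros w Hw.
pose proof (Rmin_l d (m / 2)). pose proof (Rmin_r d (m / 2)).
pose proof (Rmin_l (1 / 2) (m / (2 * (L + 1)))). pose proof (Rmin_r (1 / 2) (m / (2 * (L + 1)))).
fold d in H3, H2.
assert (Hwd : Cmod (w - z) < d) by (unfold e in Hw; lra).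
assert (B : Cmod (ev (quot h z) w) <= L).
{ eapply Rle_trans; [apply (ev_growth _ _ _ w HQ)|].
  unfold L. apply Rmult_le_compat_l; [apply HQ|].
  assert (S : sqrt (A * Cmod w) <= sqrt (A * (Cmod z + 1))).
  { apply sqrt_le_1_alt, Rmult_le_compat_l; [apply H|].
    replace w with ((w - z) + z)%C by ring.
    pose proof (Cmod_triangle (w - z) z). lra. }
  destruct S as [S|S]; [left; now apply exp_increasing | rewrite S; lra]. }
pose proof (quot_eq M A h z w H) as E.
assert (T : m <= Cmod (ev h w) + Cmod (w - z) * Cmod (ev (quot h z) w)).
{ unfold m. rewrite <- Cmod_mult.
  replace (ev h z) with (ev h w + - ((w - z) * ev (quot h z) w))%C by (rewrite E; ring).
  eapply Rle_trans; [apply Cmod_triangle|]. rewrite Cmod_opp. lra. }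
assert (T2 : Cmod (w - z) * Cmod (ev (quot h z) w) <= d * (L + 1)).
{ apply Rmult_le_compat; try apply Cmod_ge_0; lra. }
assert (T3 : d * (L + 1) <= m / 2).
{ apply Rle_trans with (m / (2 * (L + 1)) * (L + 1)); [apply Rmult_le_compat_r; lra|].
  right. field. lra. }
unfold e. lra.
Qed.

(** Compactness of a square containing the disc. The number from [ev_lower_near] is both radius and
    lower bound, so it can serve as the gauge; the 2 in its radius covers the sqrt 2 between the
    maximum norm and the modulus. *)
Lemma zero_free_lower (M A R0 : R) (h : nat -> C) : half_order_bound M A h ->
  (forall w, ev h w <> RtoC 0) -> exists d : posreal, forall w, Cmod w <= R0 -> d <= Cmod (ev h w).
Proof.
intros H Hz.
set (delta := fun x y => proj1_sig (constructive_indefinite_description _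
  (ev_lower_near M A h (x, y) H (Hz (x, y))))).
assert (Hdelta : forall x y w, Cmod (w - (x, y)) < 2 * delta x y -> delta x y <= Cmod (ev h w))
  by (intros x y; exact (proj2_sig (constructive_indefinite_description _
  (ev_lower_near M A h (x, y) H (Hz (x, y)))))).
destruct (compactness_value_2d (- R0) R0 (- R0) R0 delta) as [d Hd].
exists d. intros w Hw.
assert (Hxy : forall t, Rabs t <= R0 -> - R0 <= t <= R0) by (intros t Ht; now apply Rabs_le_between).
pose proof (Rmax_Cmod w) as Hmax.
apply NNPP. intros Hn.
apply (Hd (fst w) (snd w)).
- apply Hxy. apply Rle_trans with (2 := Hw), Rle_trans with (2 := Hmax), Rmax_l.
- apply Hxy. apply Rle_trans with (2 := Hw), Rle_trans with (2 := Hmax), Rmax_r.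
- intros [u [v [_ [_ [Hu [Hv Hle]]]]]]. apply Hn.
  apply Rle_trans with (1 := Hle). apply Hdelta.
  eapply Rle_lt_trans; [apply Cmod_2Rmax|]. simpl.
  assert (sqrt 2 <= 2) by (rewrite <- (sqrt_square 2) at 2 by lra; apply sqrt_le_1; lra).
  assert (Rmax (Rabs (fst w + - u)) (Rabs (snd w + - v)) < delta u v) by now apply Rmax_lub_lt.
  pose proof (Rabs_pos (fst w + - u)). pose proof (Rmax_l (Rabs (fst w + - u)) (Rabs (snd w + - v))).
  pose proof (sqrt_pos 2). nra.
Qed.

(** The easy half of Hurwitz's theorem: on the disc the function stays away from 0 and the Taylor
    remainders tend to 0 uniformly. *)
Lemma zero_free_psum (M A R0 : R) (h : nat -> C) : half_order_bound M A h -> 0 <= R0 ->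
  (forall w, ev h w <> RtoC 0) ->
  eventually (fun n => forall w, Cmod w <= R0 -> psum h w n <> RtoC 0).
Proof.
intros H HR Hz. destruct (zero_free_lower M A R0 h H Hz) as [d Hd].
pose proof (majorant_tail_lim M A R0 (proj1 (proj2 H)) HR) as L.
apply is_lim_seq_spec in L. destruct (L d) as [N HN].
exists N. intros n Hn w Hw E. specialize (HN n Hn). specialize (Hd w Hw).
pose proof (psum_tail M A R0 h w n H Hw) as T. rewrite E in T.
replace (ev h w - 0)%C with (ev h w) in T by ring.
apply Rabs_lt_between in HN. lra.
Qed.

Lemma lin_prod_root (l : list C) (u : C) : In u l -> u <> RtoC 0 -> lin_prod l (/ u) = RtoC 0.
Proof.
intros Hu H0. induction l as [|v l IH]; [destruct Hu|].
simpl. destruct Hu as [->|Hu].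
- rewrite Cinv_l by exact H0. ring.
- rewrite IH by exact Hu. ring.
Qed.

Lemma zero_free_trivial (M A : R) (h : nat -> C) (w : C) : half_order_bound M A h ->
  h O = RtoC 1 -> (forall w, ev h w <> RtoC 0) -> ev h w = RtoC 1.
Proof.
intros H H0 Hz. set (K := (ln M + sqrt (3 * A)) / ln 2).
(* For fixed [rho = m + 1] the degree goes to infinity; only afterwards does [rho]. *)
assert (Hb : forall m, Cmod (ev h w - 1) <= exp (Cmod w * (4 * K) * / (INR m + 1)) - 1).
{ intros m. set (rho := INR m + 1). assert (Hrho : 1 <= rho) by (unfold rho; pose proof (pos_INR m); lra).
  pose proof (Ccv_Cmod _ _ (RtoC 1) (ev_Ccv M A h w H)) as L.
  refine (is_lim_seq_le_loc _ (fun _ => _) (Finite _) (Finite _) _ L (is_lim_seq_const _)).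
  destruct (zero_free_psum M A (rho * rho) h H ltac:(nra) Hz) as [N HN].
  exists N. intros n Hn. specialize (HN n Hn).
  destruct (FTA.poly_factor h n H0) as [l Hl].
  change (forall w, psum h w n = lin_prod l w) in Hl. rewrite Hl.
  eapply Rle_trans; [apply lin_prod_near_1|]. apply Rplus_le_compat_r.
  assert (Hs : abs_sum l <= 4 * K / rho).
  { apply (abs_sum_small M A rho h n l H H0 Hrho Hl). intros u Hu.
    apply Rnot_le_lt. intros Hge.
    assert (Hu0 : u <> RtoC 0).
    { intros E. rewrite E, Cmod_0, Rmult_0_r in Hge. lra. }
    apply (HN (/ u)%C).
    - rewrite Cmod_inv by exact Hu0. pose proof (proj1 (Cmod_gt_0 u) Hu0) as P.
      apply Rmult_le_reg_r with (Cmod u); [exact P|]. rewrite Rinv_l by lra. exact Hge.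
    - rewrite Hl. now apply lin_prod_root. }
  assert (Hle : Cmod w * abs_sum l <= Cmod w * (4 * K) * / rho).
  { unfold Rdiv in Hs. rewrite Rmult_assoc. apply Rmult_le_compat_l; [apply Cmod_ge_0 | exact Hs]. }
  destruct Hle as [Hle|Hle]; [left; now apply exp_increasing | rewrite Hle; lra]. }
apply Ceq_minus, Cmod_eq_0, Rle_antisym; [|apply Cmod_ge_0].
assert (L1 : is_lim_seq (fun m => / (INR m + 1)) 0).
{ apply is_lim_seq_ext with (fun m => / INR (S m)); [intros; now rewrite S_INR|].
  apply (is_lim_seq_incr_1 (fun m => / INR m)).
  apply (is_lim_seq_inv _ p_infty); [apply is_lim_seq_INR | discriminate]. }
assert (L : is_lim_seq (fun m => exp (Cmod w * (4 * K) * / (INR m + 1)) - 1) (1 - 1)).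
{ apply is_lim_seq_minus'; [|apply is_lim_seq_const].
  replace (Finite 1) with (Finite (exp (Cmod w * (4 * K) * 0)))
    by (f_equal; rewrite Rmult_0_r; apply exp_0).
  apply (is_lim_seq_continuous exp).
  - apply derivable_continuous_pt, derivable_pt_exp.
  - apply is_lim_seq_mult'; [apply is_lim_seq_const | exact L1]. }
rewrite Rminus_diag in L.
exact (is_lim_seq_le _ _ (Finite _) (Finite _) Hb (is_lim_seq_const _) L).
Qed.

(** The quotient q by w - z is rescaled to - z q, which has constant term 1 because 0 = h_0 + z q_0.
    [M'] may exceed [M], but [A] is preserved, so the step can be iterated. *)
Lemma divide_zero (M A : R) (h : nat -> C) (z : C) : half_order_bound M A h ->
  h O = RtoC 1 -> ev h z = RtoC 0 ->
  exists M' g, half_order_bound M' A g /\ g O = RtoC 1 /\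
    forall w, ev h w = ((1 - w * / z) * ev g w)%C.
Proof.
intros H H0 Hz.
assert (E0 : ev h z = (h O + z * quot h z 0)%C).
{ unfold quot. apply (ev_shift M A _ _ h z H (half_order_shift M A h 0 H)). }
assert (z0 : z <> RtoC 0).
{ intros E. apply C1_nz. transitivity (h O + z * quot h z 0)%C.
  - rewrite H0, E. ring.
  - rewrite <- E0. exact Hz. }
pose proof (quot_bound M A h z H) as HQ.
set (g := fun k => (- z * quot h z k)%C).
set (M0 := M * A * exp (sqrt (A * Cmod z))) in HQ.
assert (Hg : half_order_bound (Cmod z * M0) A g).
{ destruct HQ as [Q1 [Q2 Q3]]. split; [apply Rmult_le_pos; [apply Cmod_ge_0 | exact Q1]|].
  split; [exact Q2|]. intros k. unfold g. rewrite Cmod_mult, Cmod_opp, Rmult_assoc.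
  apply Rmult_le_compat_l; [apply Cmod_ge_0 | apply Q3]. }
exists (Cmod z * M0), g. split; [exact Hg|]. split.
- unfold g. rewrite Hz, H0 in E0. 
  replace (- z * quot h z 0)%C with (1 - (1 + z * quot h z 0))%C by ring.
  rewrite <- E0. ring.
- intros w. rewrite (quot_eq M A h z w H), Hz.
  assert (Eg : ev g w = (- z * ev (quot h z) w)%C).
  { apply Ccv_unique with (psum g w); [now apply (ev_Ccv _ _ _ _ Hg)|].
    apply Ccv_ext with (fun n => - z * psum (quot h z) w n)%C.
    - intros n. induction n as [|n IH]; [rewrite !psum_0; reflexivity|].
      rewrite !psum_S, <- IH. unfold g. ring.
    - apply Ccv_scal. now apply (ev_Ccv _ _ _ _ HQ). }
  rewrite Eg. field. exact z0.
Qed.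

(** [L] bounds the distinct zeros, not their multiplicities. The number of divisions is bounded by
    growth: each divided factor has modulus at least 2 on the circle of radius 3 r, where [g] is at
    most B. *)
Lemma finite_zeros_polynomial (M A : R) (g : nat -> C) (L : list C) :
  half_order_bound M A g -> g O = RtoC 1 ->
  (forall z, ev g z = RtoC 0 -> In z L) ->
  exists l, forall w, ev g w = lin_prod l w.
Proof.
intros Hg g0 HL.
assert (Hr : exists r, 0 < r /\ forall z, In z L -> Cmod z <= r).
{ clear. induction L as [|z L [r [Hr IH]]].
  - exists 1. split; [lra|]. intros z [].
  - exists (r + Cmod z). pose proof (Cmod_ge_0 z). split; [lra|].
    intros y [->|Hy]; [lra|]. specialize (IH y Hy). lra. }
destruct Hr as [r [Hr HrL]].
set (B := M * exp (sqrt (A * (3 * r)))).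
destruct (nfloor_ex B) as [N HN].
{ apply Rmult_le_pos; [apply Hg | apply Rlt_le, exp_pos]. }
assert (HB : B < 2 ^ S N).
{ eapply Rlt_le_trans; [apply HN|]. rewrite <- S_INR.
  clear. induction N as [|n IH]; [simpl; lra|].
  rewrite S_INR. change (2 ^ S (S n)) with (2 * 2 ^ S n).
  pose proof (pow_R1_Rle 2 (S n) ltac:(lra)). lra. }
(* [d] counts the divisions still allowed. When none is left, the quotient is at most B / 2^(N+1) <
   1 on the circle although its value at 0 is 1, against the maximum principle. *)
assert (Hmain : forall d l h M', half_order_bound M' A h -> h O = RtoC 1 ->
  (forall z, ev h z = RtoC 0 -> In z L) ->
  (forall w, ev g w = (lin_prod l w * ev h w)%C) ->
  (forall w, Cmod w = 3 * r -> 2 ^ length l <= Cmod (lin_prod l w)) ->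
  (length l + d = S N)%nat -> exists l', forall w, ev g w = lin_prod l' w).
{ induction d as [|d IH]; intros l h M' Hh h0 HhL Hfac Hlow Hlen.
  - exfalso. rewrite Nat.add_0_r in Hlen.
    assert (P2 : 0 < 2 ^ S N) by (apply pow_lt; lra).
    assert (X : Cmod (h O) <= B / 2 ^ S N).
    { apply ev_max with M' A (3 * r); [exact Hh | lra |]. intros w Hw.
      apply Rle_div_r; [exact P2|].
      apply Rle_trans with (Cmod (ev g w)).
      - rewrite Hfac, Cmod_mult, Rmult_comm. apply Rmult_le_compat_r; [apply Cmod_ge_0|].
        rewrite <- Hlen. now apply Hlow.
      - unfold B. rewrite <- Hw. now apply ev_growth. }
    rewrite h0, Cmod_1 in X. apply Rle_div_r in X; lra.
  - destruct (classic (exists z, ev h z = RtoC 0)) as [[z Hz]|Hno].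
    + destruct (divide_zero M' A h z Hh h0 Hz) as [M2 [h2 [B2 [h20 E2]]]].
      assert (z0 : z <> RtoC 0).
      { intros E. specialize (E2 z). rewrite E in *. clear E.
        pose proof (ev_shift M' A _ _ h 0 Hh (half_order_shift M' A h 0 Hh)) as S.
        rewrite Hz, h0 in S. apply C1_nz. rewrite S. ring. }
      apply IH with (/ z :: l)%C h2 M2; auto.
      * intros y Hy. apply HhL. rewrite E2, Hy. ring.
      * intros w. rewrite Hfac, E2. simpl. ring.
      * intros w Hw. simpl. rewrite Cmod_mult. apply Rmult_le_compat; [lra | apply pow_le; lra | |now apply Hlow].
        apply factor_lower with r; [exact Hr | | exact Hw].
        rewrite Cmod_inv by exact z0. pose proof (proj1 (Cmod_gt_0 z) z0) as P.
        specialize (HrL z (HhL z Hz)).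
        apply Rmult_le_reg_r with (Cmod z); [exact P|]. rewrite Rmult_assoc, Rinv_l by lra. lra.
      * simpl. lia.
    + exists l. intros w. rewrite Hfac, (zero_free_trivial M' A h w Hh h0).
      * ring.
      * intros y Hy. apply Hno. now exists y. }
apply (Hmain (S N) nil g M Hg g0 HL).
- intros w. simpl. ring.
- intros w _. simpl. rewrite Cmod_1. lra.
- reflexivity.
Qed.

(** * Zeros of the hypergeometric function *)

Lemma Csqrt_exists (w : C) : exists z : C, (z ^ 2)%C = w.
Proof.
destruct w as [x y]. set (m := sqrt (x * x + y * y)).
assert (Hm : m * m = x * x + y * y) by (apply sqrt_sqrt; nra).
assert (Hm0 : 0 <= m) by apply sqrt_pos.
assert (H1 : 0 <= (m + x) / 2) by nra. assert (H2 : 0 <= (m - x) / 2) by nra.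
set (p := sqrt ((m + x) / 2)). set (q := sqrt ((m - x) / 2)).
assert (Hp : p * p = (m + x) / 2) by now apply sqrt_sqrt.
assert (Hq : q * q = (m - x) / 2) by now apply sqrt_sqrt.
assert (Hpq : p * q = Rabs y / 2).
{ unfold p, q. rewrite <- sqrt_mult by assumption.
  replace ((m + x) / 2 * ((m - x) / 2)) with ((m * m - x * x) / 4) by field.
  rewrite Hm. replace ((x * x + y * y - x * x) / 4) with (Rsqr (y / 2)) by (unfold Rsqr; field).
  rewrite sqrt_Rsqr_abs. unfold Rdiv. rewrite Rabs_mult, (Rabs_pos_eq (/ 2)) by lra. reflexivity. }
destruct (Rle_dec 0 y) as [Hy|Hy].
- exists (p, q). rewrite Rabs_pos_eq in Hpq by exact Hy.
  unfold Cpow, Cmult; simpl. f_equal; lra.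
- exists (p, - q). rewrite Rabs_left in Hpq by lra.
  unfold Cpow, Cmult; simpl. f_equal; lra.
Qed.

Lemma Finite_list (U : Type) (P : Ensembles.Ensemble U) : Finite_sets.Finite U P ->
  exists L, forall x, P x -> In x L.
Proof.
induction 1 as [|A _ [L HL] x _].
- exists nil. intros x [].
- exists (x :: L). intros y [z Hz|z Hz].
  + right. now apply HL.
  + left. now destruct Hz.
Qed.

Lemma fact_double_le (k : nat) : INR (fact (2 * k)) <= 4 ^ k * (INR (fact k) * INR (fact k)).
Proof.
induction k as [|k IH]; [simpl; lra|].
replace (2 * S k)%nat with (S (S (2 * k))) by lia.
rewrite !fact_S_INR, S_INR, mult_INR. change (INR 2) with 2. simpl (4 ^ S k).
pose proof (pos_INR k). pose proof (INR_fact_lt_0 (2 * k)). pose proof (INR_fact_lt_0 k).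
replace (4 * 4 ^ k * ((INR k + 1) * INR (fact k) * ((INR k + 1) * INR (fact k))))
  with ((2 * INR k + 2) * (2 * INR k + 2) * (4 ^ k * (INR (fact k) * INR (fact k)))) by ring.
rewrite <- Rmult_assoc. apply Rmult_le_compat; nra.
Qed.

Lemma lin_prod_growth (l : list C) : exists U, 0 <= U /\
  forall w, Cmod (lin_prod l w) <= (1 + U * Cmod w) ^ length l.
Proof.
exists (abs_sum l). split; [apply abs_sum_nonneg|]. intros w.
pose proof (Cmod_ge_0 w) as Hw.
induction l as [|u l IH]; simpl; [rewrite Cmod_1; lra|].
pose proof (abs_sum_nonneg l). pose proof (Cmod_ge_0 u).
rewrite Cmod_mult. apply Rmult_le_compat; try apply Cmod_ge_0.
- pose proof (Cmod_triangle 1 (- (w * u))) as T. rewrite Cmod_opp, Cmod_mult, Cmod_1 in T.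
  replace (1 + - (w * u))%C with (1 - w * u)%C in T by ring. nra.
- eapply Rle_trans; [exact IH|]. apply pow_incr. split; nra.
Qed.

Section Hypergeometric.
Variables a b c : R.
Hypothesis Ha : 0 < a <= b.
Hypothesis Hc : 0 < c.

Let h (k : nat) : C := RtoC (hyp1F2_coeff a b c k).

Lemma hyp1F2_coeff_pos (k : nat) : 0 < hyp1F2_coeff a b c k.
Proof.
apply Rdiv_lt_0_compat; [apply pochhammer_pos; lra|].
repeat apply Rmult_lt_0_compat;
  [apply INR_fact_lt_0 | apply pochhammer_pos; lra | apply pochhammer_pos; lra].
Qed.

(** With e = min (c, 1): (a)_k <= (b)_k, c + j >= e (j + 1) gives (c)_k >= e^k k!, and (2k)! <= 4^k
    (k!)^2. *)
Lemma hyp1F2_half_order : half_order_bound 1 (4 / Rmin c 1) h.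
Proof.
set (e := Rmin c 1). assert (He : 0 < e) by (apply Rmin_pos; lra).
split; [lra|]. split; [apply Rlt_le, Rdiv_lt_0_compat; lra|].
intros k. unfold h. rewrite Cmod_R, Rabs_pos_eq, Rmult_1_l by apply Rlt_le, hyp1F2_coeff_pos.
unfold hyp1F2_coeff.
pose proof (poch_le a b k Ha) as Lab. pose proof (pochhammer_pos a k ltac:(lra)) as Pa.
pose proof (pochhammer_pos b k ltac:(lra)) as Pb. pose proof (pochhammer_pos c k Hc) as Pc.
pose proof (INR_fact_lt_0 k) as Pk. pose proof (INR_fact_lt_0 (2 * k)) as P2k.
pose proof (pow_lt e k He) as Pe. pose proof (pow_lt 4 k ltac:(lra)) as P4.
assert (Lc : e ^ k * INR (fact k) <= poch c k).
{ clear - He Hc. subst e. pose proof (Rmin_l c 1). pose proof (Rmin_r c 1).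
  induction k as [|k IH]; [simpl; lra|].
  rewrite fact_S_INR. cbn [pochhammer pow]. set (e := Rmin c 1) in *.
  pose proof (pos_INR k). pose proof (INR_fact_lt_0 k). pose proof (pow_lt e k He).
  replace (e * e ^ k * ((INR k + 1) * INR (fact k)))
    with (e ^ k * INR (fact k) * (e * (INR k + 1))) by ring.
  apply Rmult_le_compat; nra. }
apply Rle_trans with (/ (INR (fact k) * (e ^ k * INR (fact k)))).
- apply Rle_trans with (poch b k / (INR (fact k) * poch b k * poch c k)).
  + apply Rmult_le_compat_r; [|exact Lab]. apply Rlt_le, Rinv_0_lt_compat.
    repeat apply Rmult_lt_0_compat; auto.
  + replace (poch b k / (INR (fact k) * poch b k * poch c k))
      with (/ (INR (fact k) * poch c k)) by (field; lra).
    apply Rinv_le_contravar; [repeat apply Rmult_lt_0_compat; auto|].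
    apply Rmult_le_compat_l; lra.
- unfold Rdiv. rewrite Rpow_mult_distr, pow_inv.
  replace (/ (INR (fact k) * (e ^ k * INR (fact k))))
    with (4 ^ k * / e ^ k * / (4 ^ k * (INR (fact k) * INR (fact k)))) by (field; lra).
  apply Rmult_le_compat_l.
  + apply Rmult_le_pos; [lra | now apply Rlt_le, Rinv_0_lt_compat].
  + apply Rinv_le_contravar; [exact P2k | apply fact_double_le].
Qed.

Lemma hyp1F2_psum_real (x : R) (n : nat) :
  psum h (RtoC x) n = RtoC (sum (fun k => hyp1F2_coeff a b c k * x ^ k) n).
Proof.
induction n as [|n IH].
- rewrite psum_0. unfold h. simpl. f_equal. ring.
- rewrite psum_S, IH, tech5. unfold h. now rewrite <- RtoC_pow, <- RtoC_mult, <- RtoC_plus.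
Qed.

(** All terms are nonnegative at x >= 0, so each is a lower bound. Term 0 rules out purely imaginary
    zeros in z; the higher terms rule out polynomials. *)
Lemma hyp1F2_lower (x : R) (k : nat) : 0 <= x ->
  hyp1F2_coeff a b c k * x ^ k <= Cmod (hyp1F2 a b c (RtoC x)).
Proof.
intros Hx. pose proof (Ccv_Cmod _ _ (RtoC 0) (ev_Ccv _ _ _ (RtoC x) hyp1F2_half_order)) as L.
change (ev h (RtoC x)) with (hyp1F2 a b c (RtoC x)) in L.
replace (hyp1F2 a b c (RtoC x) - 0)%C with (hyp1F2 a b c (RtoC x)) in L by ring.
refine (is_lim_seq_le_loc (fun _ => _) _ (Finite _) (Finite _) _ (is_lim_seq_const _) L).
assert (P : forall j, 0 <= hyp1F2_coeff a b c j * x ^ j)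
  by (intros; apply Rmult_le_pos; [apply Rlt_le, hyp1F2_coeff_pos | now apply pow_le]).
exists k. intros n Hn.
replace (psum h x n - 0)%C with (psum h x n) by ring.
rewrite hyp1F2_psum_real, Cmod_R, Rabs_pos_eq by now apply cond_pos_sum.
induction Hn as [|n Hn IH].
- destruct k as [|k]; [simpl; lra|]. rewrite tech5.
  pose proof (cond_pos_sum _ k P). lra.
- rewrite tech5. specialize (P (S n)). lra.
Qed.

Lemma hyp1F2_real_series (x : R) :
  is_series (fun k => hyp1F2_coeff a b c k * x ^ k) (Re (hyp1F2 a b c (RtoC x))).
Proof.
unfold hyp1F2, CSeries, Re at 1. cbn [fst].
rewrite (Series_ext _ (fun k => hyp1F2_coeff a b c k * x ^ k))
  by (intros k; now rewrite <- RtoC_pow, <- RtoC_mult).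
apply Series_correct.
apply (@ex_series_le R_AbsRing R_CompleteNormedModule _ (majorant 1 (4 / Rmin c 1) (Rabs x))).
- intros k. change (Rabs (hyp1F2_coeff a b c k * x ^ k) <= majorant 1 (4 / Rmin c 1) (Rabs x) k).
  rewrite <- Cmod_R, RtoC_mult, RtoC_pow. apply (term_dom _ _ _ h); [apply hyp1F2_half_order|].
  rewrite Cmod_R. lra.
- apply majorant_summable; [apply hyp1F2_half_order | apply Rabs_pos].
Qed.

Lemma hyp1F2_not_polynomial (l : list C) : ~ forall w, hyp1F2 a b c w = lin_prod l w.
Proof.
intros E. destruct (lin_prod_growth l) as [U [HU HG]].
set (n := length l) in *. pose proof (hyp1F2_coeff_pos (S n)) as Pc.
(* For x >= 1 a product of n linear factors is at most (1 + U)^n x^n; at x = 1 + q the term of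
   degree n + 1 exceeds this. *)
set (q := (1 + U) ^ n / hyp1F2_coeff a b c (S n)).
assert (Hq : 0 < q) by (apply Rdiv_lt_0_compat; [apply pow_lt; lra | exact Pc]).
set (x := 1 + q). pose proof (hyp1F2_lower x (S n) ltac:(unfold x; lra)) as Lo.
rewrite E in Lo. specialize (HG (RtoC x)). rewrite Cmod_R, Rabs_pos_eq in HG by (unfold x; lra).
assert (Px : 0 < x ^ n) by (apply pow_lt; unfold x; lra).
assert (Up : (1 + U * x) ^ n <= (1 + U) ^ n * x ^ n).
{ rewrite <- Rpow_mult_distr. apply pow_incr. unfold x. nra. }
simpl (x ^ S n) in Lo.
assert (C1 : hyp1F2_coeff a b c (S n) * x <= (1 + U) ^ n).
{ apply Rmult_le_reg_r with (x ^ n); [exact Px|]. lra. }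
assert (C2 : hyp1F2_coeff a b c (S n) * q = (1 + U) ^ n) by (unfold q; field; lra).
unfold x in C1. lra.
Qed.

Lemma hyp1F2_infinitely_many_zeros (L : list C) :
  exists w, hyp1F2 a b c w = RtoC 0 /\ ~ In w L.
Proof.
apply NNPP. intros Hno.
destruct (finite_zeros_polynomial _ _ h L hyp1F2_half_order) as [l Hl].
- unfold h, hyp1F2_coeff. simpl. f_equal. field.
- intros z Hz. apply NNPP. intros Hn. apply Hno. now exists z.
- exact (hyp1F2_not_polynomial l Hl).
Qed.
End Hypergeometric.

Theorem theorem7p1 (a b c : R) (ha : a > 0)
    (hP : region_P a (b, c)) (hS : ~ set_S a (b, c)) :
  let Phi : C -> C := fun z => hyp1F2 a b c (- (z ^ 2 / 4))%C in
  ~ laguerre_polya Phi /\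
  ~ Finite_sets.Finite C (fun z => Phi z = RtoC 0 /\ Im z <> 0) /\
  (forall z : C, Phi z = RtoC 0 -> Im z <> 0 -> Re z <> 0).
Proof.
intros Phi. destruct hP as [hb hc].
pose proof (Rmax_l (3 * a + 1 / 2 - b) (a + a / (2 * (b - a)))) as M1.
pose proof (Rmax_r (3 * a + 1 / 2 - b) (a + a / (2 * (b - a)))) as M2.
assert (Hp : 0 < b - a) by lra.
assert (Hd : 0 < a / (2 * (b - a))) by (apply Rdiv_lt_0_compat; lra).
assert (Hq : 0 < c - a) by lra.
assert (Hpq : a / 2 <= (b - a) * (c - a)).
{ replace (a / 2) with ((b - a) * (a / (2 * (b - a)))) by (field; lra).
  apply Rmult_le_compat_l; lra. }
set (s := (b + c - a - 1 / 2) / 2).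
assert (Hs : 2 * s = b + c - a - 1 / 2) by (unfold s; field).
assert (Has : 0 < a <= s) by (unfold s; lra).
assert (Hst : 2 * a < 2 * s \/ a / 2 < (b - a) * (c - a)).
{ destruct (Rlt_or_le (2 * a) (2 * s)) as [H|H]; [now left|].
  destruct (Rlt_or_le (a / 2) ((b - a) * (c - a))) as [H'|H']; [now right|].
  exfalso. apply hS. assert (Es : c = 3 * a + 1 / 2 - b) by lra.
  (* With p + q = a + 1/2 and p q = a/2, p = b - a is a root of (p - a) (p - 1/2), so (b, c) lies in
     S_a. *)
  assert (F : (b - 2 * a) * (b - a - 1 / 2) = 0) by (subst c; nra).
  apply Rmult_integral in F. destruct F as [F|F]; [right | left]; f_equal; lra. }
assert (Hab : 0 < a <= b) by lra. assert (H0c : 0 < c) by lra.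
assert (Hge1 : forall x, 0 <= x -> hyp1F2 a b c (RtoC x) <> RtoC 0).
{ intros x Hx E. pose proof (hyp1F2_lower a b c Hab H0c x 0 Hx) as Lo.
  rewrite E, Cmod_0 in Lo. pose proof (hyp1F2_coeff_pos a b c Hab H0c 0). simpl in Lo. lra. }
assert (Hreal : forall z, Phi z = RtoC 0 -> Im z <> 0).
{ intros [x y] Hz Hy. simpl in Hy. subst y. unfold Phi in Hz.
  replace (- ((x, 0) ^ 2 / 4))%C with (RtoC (- (x * x / 4))) in Hz.
  2:{ change (x, 0) with (RtoC x). rewrite <- RtoC_pow, <- RtoC_div, <- RtoC_opp by lra.
      f_equal. field. }
  destruct (Req_dec x 0) as [->|Hx].
  - apply (Hge1 (- (0 * 0 / 4))); [lra | exact Hz].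
  - pose proof (hyp1F2_real_series a b c Hab H0c (- (x * x / 4))) as Hser.
    rewrite Hz in Hser.
    assert (W : 0 < x * x / 4) by nra.
    apply (gasper_positive a b c s Has Hp Hq Hs Hpq _ _ W Hst) in Hser.
    simpl in Hser. lra. }
assert (Hinf : ~ Finite_sets.Finite C (fun z => Phi z = RtoC 0 /\ Im z <> 0)).
{ intros HF. destruct (Finite_list _ _ HF) as [L HL].
  destruct (hyp1F2_infinitely_many_zeros a b c Hab H0c
    (map (fun z => (- (z ^ 2 / 4))%C) L)) as [w [Hw Hn]].
  (* Every w has the form - z^2 / 4, so a zero w outside the image of the list gives a zero z
     outside the list. *)
  destruct (Csqrt_exists (- (4 * w))) as [z Hz].
  assert (E : (- (z ^ 2 / 4))%C = w) by (rewrite Hz; field).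
  apply Hn. rewrite <- E. apply (in_map (fun z => (- (z ^ 2 / 4))%C)), HL.
  assert (Hz0 : Phi z = RtoC 0) by (unfold Phi; now rewrite E).
  split; [exact Hz0 | now apply Hreal]. }
split; [|split; [exact Hinf|]].
- intros [_ [Hzeros _]]. apply Hinf.
  (* Membership in the Laguerre-Pólya class would leave no non-real zeros, and the empty set is
     finite. *)
  replace (fun z : C => Phi z = RtoC 0 /\ Im z <> 0) with (Ensembles.Empty_set C).
  + constructor.
  + apply Ensembles.Extensionality_Ensembles. split; intros z Hz; [destruct Hz|].
    destruct Hz as [Hz1 Hz2]. now apply Hzeros in Hz1.
- intros [x y] Hz Hy Hx. simpl in Hx. subst x. unfold Phi in Hz.
  replace (- ((0, y) ^ 2 / 4))%C with (RtoC (y * y / 4)) in Hz.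
  + apply (Hge1 (y * y / 4)); [nra | exact Hz].
  + replace ((0, y) ^ 2)%C with (RtoC (- (y * y))).
    * rewrite <- RtoC_div, <- RtoC_opp by lra. f_equal. field.
    * unfold RtoC, Cpow, Cmult. simpl. f_equal; ring.
Qed.
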